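(* Let $\mathfrak g_A=\mathbb Re_0\ltimes_A\mathbb R^5$ with $A$ a real diagonal $5\times5$ matrix whose spectrum (as a multiset) contains neither two identical pairs nor two opposite pairs. Then no left-invariant generalized complex structure of type $1$ or $2$ on $G_A$ has a closed invariant pure-spinor generator.
   Context: Two identical pairs means four entries of the multiset, at disjoint occurrences, grouped as $\{r,r\}$ and $\{s,s\}$; two opposite pairs means four entries, at disjoint occurrences, grouped as $\{r,-r\}$ and $\{s,-s\}$ (two zero entries form an opposite pair). $\mathfrak g_A$ has abelian ideal $\mathbb R^5$ and bracket $[e_0,v]=Av$; $G_A$ is the simply connected Lie group with Lie algebra $\mathfrak g_A$. Left-invariant generalized complex structures: for a Lie group $G$ with Lie algebra $\mathfrak g$ of real dimension $2n$ (here $n=3$), give $\mathfrak g\oplus\mathfrak g^*$ the pairing $\langle X+\xi,Y+\eta\rangle=\frac12(\xi(Y)+\eta(X))$. A left-invariant generalized complex structure on $G$ is (equivalently) a linear map $\mathcal J$ of $\mathfrak g\oplus\mathfrak g^*$ with $\mathcal J^2=-\mathrm{Id}$, orthogonal for the pairing, whose $\mathbf i$-eigenspace $L\subset(\mathfrak g\oplus\mathfrak g^* )\otimes\mathbb C$ is closed under the Courant bracket on left-invariant sections, $[[X+\xi,Y+\eta]]=[X,Y]+\mathrm{ad}^*_X\eta-\mathrm{ad}^*_Y\xi$, with $(\mathrm{ad}^*_X\eta)(Y)=-\eta([X,Y])$ (extended $\mathbb C$-bilinearly). The space $L$ is the annihilator, for the Clifford action $(X+\xi)\cdot\rho=\iota_X\rho+\xi\wedge\rho$,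 of a unique complex line $K_L\subset\bigwedge^\bullet\mathfrak g^*\otimes\mathbb C$. Any generator $\rho$ of $K_L$ (an invariant pure-spinor generator) has the form $\rho=\exp(B+\mathbf i\omega)\wedge\Omega$ with $B,\omega\in\bigwedge^2\mathfrak g^*$ real and $\Omega=\theta_1\wedge\cdots\wedge\theta_k$ with linearly independent $\theta_i\in\mathfrak g^*\otimes\mathbb C$ ($\Omega$ a nonzero constant if $k=0$), and satisfies $\omega^{n-k}\wedge\Omega\wedge\overline\Omega\ne0$; $k\in\{0,\dots,n\}$ is the type. The generator is closed if $\mathrm d\rho=0$, where $\mathrm d$ is the derivation with $\mathrm d\xi(X,Y)=-\xi([X,Y])$ for $\xi\in\mathfrak g^*$. *)

(* Defs.v *)
From HB Require Import structures.
From mathcomp Require Import all_boot all_order all_algebra.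
From mathcomp Require Import reals.
From mathcomp Require Import complex.

Set Implicit Arguments.
Unset Strict Implicit.
Unset Printing Implicit Defensive.

Import Order.TTheory GRing.Theory Num.Theory.
Local Open Scope ring_scope.

(* Conventions.  A vector space of dimension m over F, with its standard      *)
(* basis e_0, ..., e_{m-1}, is 'rV[F]_m; its dual is again 'rV[F]_m, in the   *)
(* dual basis e^0, ..., e^{m-1}.  Linear maps act on row vectors on the       *)
(* right: the image of u under J is u *m J.                                   *)

(** * Exterior algebra of the dual space *)

(* An element of the exterior algebra is the family of its coordinates in the *)
(* basis e^I = e^{i_1} /\ ... /\ e^{i_p}, I = {i_1 < ... < i_p}.             *)
Definition ext (F : fieldType) (m : nat) : Type := {ffun {set 'I_m} -> F}.
Identity Coercion ext_ffun : ext >-> finfun_of.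
HB.instance Definition _ F m := GRing.Zmodule.on (ext F m).

Section ExtLmodule.
Variables (F : fieldType) (m : nat).
Implicit Types (s t : F) (a b : ext F m).

Definition ext_scale t a : ext F m := [ffun I => t * a I].

Fact ext_scaleA s t a : ext_scale s (ext_scale t a) = ext_scale (s * t) a.
Proof. by apply/ffunP => I; rewrite !ffunE mulrA. Qed.

Fact ext_scale1 : left_id 1 ext_scale.
Proof. by move=> a; apply/ffunP => I; rewrite ffunE mul1r. Qed.

Fact ext_scaleDr : right_distributive ext_scale +%R.
Proof. by move=> t a b; apply/ffunP => I; rewrite !ffunE mulrDr. Qed.

Fact ext_scaleDl a : {morph ext_scale^~ a : s t / s + t}.
Proof. by move=> s t; apply/ffunP => I; rewrite !ffunE mulrDl. Qed.

HB.instance Definition _ := GRing.Zmodule_isLmodule.Build F (ext F m)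
  ext_scaleA ext_scale1 ext_scaleDr ext_scaleDl.

Lemma ext_scaleE t a I : (t *: a) I = t * a I. Proof. by rewrite ffunE. Qed.

Lemma ext_addE a b I : (a + b) I = a I + b I. Proof. by rewrite ffunE. Qed.

Lemma ext_sumE (T : Type) (r : seq T) (P : pred T) (f : T -> ext F m) I :
  (\sum_(i <- r | P i) f i) I = \sum_(i <- r | P i) f i I.
Proof. exact: sum_ffunE. Qed.

End ExtLmodule.

Section Exterior.
Variables (F : fieldType) (m : nat).
Implicit Types (I J K : {set 'I_m}) (X xi : 'rV[F]_m) (a b c : ext F m).

Definition ebasis I : ext F m := [ffun J : {set 'I_m} => (J == I)%:R].

Definition ext1 : ext F m := ebasis set0.

Definition covec xi : ext F m := \sum_(i < m) xi 0 i *: ebasis [set i].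

(* (-1) ^ (number of (i, j) in I x J with j < i), the sign of the shuffle     *)
(* sorting e^I /\ e^J when I and J are disjoint.                              *)
Definition wsign I J : F := \prod_(i in I) \prod_(j in J) (-1) ^+ (j < i)%N.

Definition wedge a b : ext F m :=
  [ffun K : {set 'I_m} => \sum_(I : {set 'I_m} | I \subset K)
               wsign I (K :\: I) * a I * b (K :\: I)].

Definition interior X a : ext F m :=
  [ffun K : {set 'I_m} => \sum_(i < m | i \notin K) wsign [set i] K * X 0 i * a (i |: K)].

Definition homogeneous (p : nat) a := forall I, a I != 0 -> #|I| = p.

Definition wedge_pow a (k : nat) : ext F m := iter k (wedge a) ext1.

(* The exponential series; in characteristic 0, for a without constant term,  *)
(* the omitted powers vanish.                                                 *)
Definition wedge_exp a : ext F m :=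
  \sum_(k < m.+1) (k`!%:R)^-1 *: wedge_pow a k.

(* theta_1 /\ ... /\ theta_k for the rows theta_i of a matrix. *)
Definition wedge_rows (k : nat) (theta : 'M[F]_(k, m)) : ext F m :=
  \big[wedge/ext1]_(i < k) covec (row i theta).

End Exterior.

(** * Lie algebras, the Courant bracket and the Chevalley-Eilenberg complex *)

Section LieAlgebra.
Variables (F : fieldType) (m : nat) (br : 'rV[F]_m -> 'rV[F]_m -> 'rV[F]_m).
Implicit Types (X Y xi eta : 'rV[F]_m) (u v : 'rV[F]_(m + m)) (a : ext F m).

Definition dual_ev xi Y : F := \sum_(i < m) xi 0 i * Y 0 i.

(* (ad^*_X eta)(Y) = - eta([X, Y]), given by its values at the e_i. *)
Definition coad X eta : 'rV[F]_m :=
  \row_(i < m) - dual_ev eta (br X (delta_mx 0 i)).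

(* An element X + xi of g (+) g^* is the block row vector (X, xi). *)
Definition gpair u v : F :=
  2^-1 * (dual_ev (rsubmx u) (lsubmx v) + dual_ev (rsubmx v) (lsubmx u)).

Definition courant u v : 'rV[F]_(m + m) :=
  row_mx (br (lsubmx u) (lsubmx v))
         (coad (lsubmx u) (rsubmx v) - coad (lsubmx v) (rsubmx u)).

Definition clifford u a : ext F m :=
  interior (lsubmx u) a + wedge (covec (rsubmx u)) a.

(* d xi (X, Y) = - xi([X, Y]), where (e^i /\ e^j)(e_i, e_j) = 1. *)
Definition ce_d1 xi : ext F m :=
  \sum_(i < m) \sum_(j < m | (i < j)%N)
    - dual_ev xi (br (delta_mx 0 i) (delta_mx 0 j)) *:
      wedge (ebasis F [set i]) (ebasis F [set j]).

(* The derivation extending ce_d1 (see ce_d_covec and ce_d_leibniz): on e^I,  *)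
(* each factor e^k is replaced in turn by its differential.                   *)
Definition ce_d a : ext F m :=
  \sum_(k < m) wedge (ce_d1 (delta_mx 0 k)) (interior (delta_mx 0 k) a).

End LieAlgebra.

(** ** [ce_d] is the derivation extending [ce_d1] *)

Section Derivation.
Variables (F : fieldType) (m : nat).
Implicit Types (I J K : {set 'I_m}) (X xi : 'rV[F]_m) (a b c : ext F m).
Local Notation e I := (ebasis F I).
Local Notation w I J := (wsign F I J).

Lemma ext_decomp a : a = \sum_I a I *: e I.
Proof.
apply/ffunP => J; rewrite ext_sumE (bigD1 J) //= big1 ?addr0 => [|I nIJ].
  by rewrite ext_scaleE ffunE eqxx mulr1.
by rewrite ext_scaleE ffunE eq_sym (negPf nIJ) mulr0.
Qed.

Lemma wedge_is_linear a : linear (wedge a).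
Proof.
move=> t b c; apply/ffunP => K; rewrite !ffunE mulr_sumr -big_split /=.
by apply: eq_bigr => I _; rewrite !ffunE mulrDr mulrCA.
Qed.

HB.instance Definition _ a :=
  GRing.isLinear.Build F (ext F m) (ext F m) *:%R (wedge a) (wedge_is_linear a).

Definition wedger b a := wedge a b.

Lemma wedger_is_linear b : linear (wedger b).
Proof.
move=> t a c; apply/ffunP => K; rewrite !ffunE mulr_sumr -big_split /=.
by apply: eq_bigr => I _; rewrite !ffunE mulrDr mulrDl !mulrA [_ * t]mulrC.
Qed.

HB.instance Definition _ b :=
  GRing.isLinear.Build F (ext F m) (ext F m) *:%R (wedger b)
    (wedger_is_linear b).

Lemma interior_is_linear X : linear (interior X).
Proof.
move=> t b c; apply/ffunP => K; rewrite !ffunE mulr_sumr -big_split /=.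
by apply: eq_bigr => i _; rewrite !ffunE mulrDr mulrCA.
Qed.

HB.instance Definition _ X :=
  GRing.isLinear.Build F (ext F m) (ext F m) *:%R (interior X)
    (interior_is_linear X).

Lemma prod_setU I J (f : 'I_m -> F) : [disjoint I & J] ->
  \prod_(i in I :|: J) f i = (\prod_(i in I) f i) * (\prod_(i in J) f i).
Proof.
move=> dIJ; rewrite -bigU //.
by apply: eq_bigl => i; rewrite !inE.
Qed.

Lemma wsignUl I J K : [disjoint I & J] -> w (I :|: J) K = w I K * w J K.
Proof. exact: prod_setU. Qed.

Lemma wsignUr I J K : [disjoint J & K] -> w I (J :|: K) = w I J * w I K.
Proof.
by move=> dJK; rewrite /wsign -big_split; apply: eq_bigr => i _; exact: prod_setU.
Qed.

Lemma wsign_sq I J : w I J * w I J = 1.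
Proof.
rewrite /wsign -big_split big1 // => i _; rewrite -big_split big1 // => j _.
by case: (j < i)%N; rewrite /= ?expr0 ?expr1 ?mulrNN mulr1.
Qed.

Lemma wsignC I J : [disjoint I & J] -> w I J * w J I = (-1) ^+ (#|I| * #|J|).
Proof.
move=> dIJ; rewrite /wsign [X in _ * X]exchange_big /= -big_split /=.
rewrite mulnC exprM -prodr_const; apply: eq_bigr => i iI.
rewrite -big_split -prodr_const; apply: eq_bigr => j jJ /=.
case: (ltngtP i j) => [_|_|/val_inj eij]; rewrite ?mulr1 ?mul1r //.
by move: (disjointFr dIJ iI); rewrite eij jJ.
Qed.

Lemma wedge_basis I J :
  wedge (e I) (e J) = if [disjoint I & J] then w I J *: e (I :|: J) else 0.
Proof.
apply/ffunP => K; rewrite !ffunE.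
have -> : \sum_(H : {set 'I_m} | H \subset K)
    wsign F H (K :\: H) * e I H * e J (K :\: H) =
  if (I \subset K) && (K :\: I == J) then w I J else 0.
  case: ifP => [/andP[sIK /eqP <-]|nIK].
    rewrite (bigD1 I) //= !ffunE !eqxx !mulr1 big1 ?addr0 // => H /andP[_ nHI].
    by rewrite !ffunE (negPf nHI) mulr0 mul0r.
  rewrite big1 // => H sHK; rewrite !ffunE.
  case: eqP => [eHI|]; last by rewrite mulr0 mul0r.
  by move: nIK; rewrite -eHI sHK /= => ->; rewrite mulr0.
have [dIJ|ndIJ] := boolP [disjoint I & J]; rewrite ?ffunE.
  have -> : (I \subset K) && (K :\: I == J) = (K == I :|: J).
    apply/andP/eqP => [[sIK /eqP <-]|->].
      by rewrite setDE setUIr setUCr setIT; apply/esym/setUidPr.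
    rewrite subsetUl setDUl setDv set0U; split=> //.
    by apply/eqP/setDidPl; rewrite disjoint_sym.
  by case: eqP; rewrite ?mulr1 ?mulr0.
case: ifP => // /andP[_ /eqP eJ]; case/negP: ndIJ.
by rewrite -eJ disjoint_sym disjoints_subset setDE subsetIr.
Qed.

Lemma interior_basis k I : interior (delta_mx 0 k) (e I) =
  if k \in I then w [set k] (I :\ k) *: e (I :\ k) else 0.
Proof.
apply/ffunP => K; rewrite !ffunE.
transitivity (if (k \notin K) && (k |: K == I) then w [set k] K else 0).
  rewrite big_mkcond (bigD1 k) //= big1 ?addr0 => [|i nik].
    rewrite !ffunE !mxE !eqxx mulr1; case: (k \notin K) => //=.
    by case: eqP; rewrite ?mulr1 ?mulr0.
  by rewrite !mxE (negPf nik) mulr0 mul0r; case: ifP.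
have -> : (k \notin K) && (k |: K == I) = (k \in I) && (K == I :\ k).
  apply/andP/andP => -[h /eqP h']; split.
  - by rewrite -h' setU11.
  - by rewrite -h' setU1K.
  - by rewrite h' setD11.
  - by rewrite h' setD1K.
case: (k \in I) => //=; rewrite ?ffunE //=.
by case: eqP => [->|]; rewrite ?mulr1 ?mulr0.
Qed.

Lemma wedge_suml (T : Type) (r : seq T) P (f : T -> ext F m) b :
  wedge (\sum_(i <- r | P i) f i) b = \sum_(i <- r | P i) wedge (f i) b.
Proof. exact: (raddf_sum (wedger b)). Qed.

Lemma wedgeZl t a b : wedge (t *: a) b = t *: wedge a b.
Proof. by rewrite -[LHS]/(wedger b (t *: a)) linearZ. Qed.

Lemma wedge0l b : wedge 0 b = 0. Proof. exact: (raddf0 (wedger b)). Qed.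

Lemma wedge_sumr (T : Type) (r : seq T) P a (f : T -> ext F m) :
  wedge a (\sum_(i <- r | P i) f i) = \sum_(i <- r | P i) wedge a (f i).
Proof. exact: raddf_sum. Qed.

Lemma wedgeZr t a b : wedge a (t *: b) = t *: wedge a b.
Proof. by rewrite linearZ. Qed.

Lemma wedge0r a : wedge a 0 = 0. Proof. exact: raddf0. Qed.

Lemma wedgeA a b c : wedge a (wedge b c) = wedge (wedge a b) c.
Proof.
rewrite (ext_decomp a) !wedge_suml; apply: eq_bigr => I _.
rewrite !wedgeZl; congr (_ *: _).
rewrite (ext_decomp b) wedge_suml !wedge_sumr wedge_suml.
apply: eq_bigr => J _; rewrite !(wedgeZl, wedgeZr); congr (_ *: _).
rewrite (ext_decomp c) !wedge_sumr; apply: eq_bigr => K _.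
rewrite !wedgeZr; congr (_ *: _); rewrite !wedge_basis.
have [dJK|nJK] := boolP [disjoint J & K];
  have [dIJ|nIJ] := boolP [disjoint I & J].
- rewrite wedgeZr wedgeZl !wedge_basis.
  rewrite -!setI_eq0 setIUl setIUr !setU_eq0 !setI_eq0 dIJ dJK /= andbT.
  case: ifP => dIK; last by rewrite !scaler0.
  by rewrite !scalerA wsignUl // wsignUr // setUA mulrC -mulrA.
- rewrite wedge0l wedgeZr wedge_basis /= -setI_eq0 setIUr setU_eq0 setI_eq0.
  by rewrite (negPf nIJ) scaler0.
- rewrite wedgeZl wedge0r wedge_basis -setI_eq0 setIUl setU_eq0.
  by rewrite !setI_eq0 (negPf nJK) andbF scaler0.
- by rewrite wedge0l wedge0r.
Qed.

Lemma wedgeC_even I b : ~~ odd #|I| -> wedge (e I) b = wedge b (e I).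
Proof.
move=> evI; rewrite (ext_decomp b) wedge_sumr wedge_suml.
apply: eq_bigr => J _; rewrite wedgeZr wedgeZl; congr (_ *: _).
rewrite !wedge_basis disjoint_sym; case: ifP => // dJI; rewrite setUC.
congr (_ *: _); rewrite -[LHS]mulr1 -(wsign_sq J I) mulrA wsignC.
  by rewrite -signr_odd oddM (negPf evI) mul1r.
by rewrite disjoint_sym.
Qed.

Lemma wsign_split k I J : k \in I ->
  (w I J = w [set k] J * w (I :\ k) J) * (w J I = w J [set k] * w J (I :\ k)).
Proof.
move=> kI; rewrite -{1 3}(setD1K kI).
by rewrite wsignUl ?wsignUr ?disjoints1 ?setD11.
Qed.

Lemma interior_wedge_basis k I J :
  interior (delta_mx 0 k) (wedge (e I) (e J)) =
  wedge (interior (delta_mx 0 k) (e I)) (e J) +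
  (-1) ^+ #|I| *: wedge (e I) (interior (delta_mx 0 k) (e J)).
Proof.
rewrite !interior_basis wedge_basis.
have [kI|kI] := boolP (k \in I); have [kJ|kJ] := boolP (k \in J).
- have -> : [disjoint I & J] = false.
    by apply/negP => /disjointFr/(_ kI); rewrite kJ.
  rewrite linear0 wedgeZl wedgeZr !wedge_basis.
  have -> : [disjoint I & J :\ k] = [disjoint I :\ k & J].
    by rewrite -!setI_eq0 setIDA setIDAC.
  case: ifP => dIJ; last by rewrite !scaler0 addr0.
  have -> : I :|: J :\ k = I :\ k :|: J.
    apply/setP => x; rewrite !inE.
    by case: eqP => [->|_] /=; rewrite ?kI ?kJ ?orbT.
  rewrite !scalerA -scalerDl.
  rewrite (wsign_split (I :\ k) kJ).2 (wsign_split (J :\ k) kI).1.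
  rewrite mulrA wsignC ?disjoints1 ?setD11 // cards1 mul1n.
  rewrite -[_ * w [set k] _ * _]mulrA [w [set k] _ * (_ * _)]mulrA wsign_sq mul1r.
  by rewrite (cardsD1 k I) kI exprS mulN1r mulNr addrN scale0r.
- rewrite wedge0r scaler0 addr0 wedgeZl wedge_basis.
  have -> : [disjoint I :\ k & J] = [disjoint I & J].
    rewrite -!setI_eq0 setIDAC; congr (_ == _); apply/setDidPl.
    by rewrite disjoint_sym disjoints1 inE (negPf kJ) andbF.
  case: ifP => dIJ; last by rewrite scaler0 linear0.
  rewrite linearZ /= interior_basis inE kI /=.
  have -> : (I :|: J) :\ k = I :\ k :|: J.
    by rewrite setDUl; congr (_ :|: _); apply/setDidPl;
       rewrite disjoint_sym disjoints1.
  rewrite !scalerA (wsign_split J kI).1 wsignUr; last first.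
    by rewrite disjoint_sym (disjointWr (subsetDl _ _)) // disjoint_sym.
  by rewrite [w [set k] J * _]mulrC mulrACA wsign_sq mulr1 mulrC.
- rewrite wedge0l add0r wedgeZr wedge_basis.
  have -> : [disjoint I & J :\ k] = [disjoint I & J].
    rewrite -!setI_eq0 setIDA; congr (_ == _); apply/setDidPl.
    by rewrite disjoint_sym disjoints1 inE (negPf kI).
  case: ifP => dIJ; last by rewrite !scaler0 linear0.
  rewrite linearZ /= interior_basis inE kJ orbT.
  have -> : (I :|: J) :\ k = I :|: J :\ k.
    by rewrite setDUl; congr (_ :|: _); apply/setDidPl;
       rewrite disjoint_sym disjoints1.
  rewrite !scalerA (wsign_split I kJ).2 wsignUr; last first.
    by rewrite (disjointWr (subsetDl _ _)).
  have -> : (-1) ^+ #|I| = w I [set k] * w [set k] I.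
    by rewrite wsignC ?cards1 ?muln1 // disjoint_sym disjoints1.
  by rewrite mulrACA [w I (J :\ k) * _]mulrC !mulrA.
- rewrite wedge0l wedge0r scaler0 addr0; case: ifP => _; last exact: linear0.
  by rewrite linearZ /= interior_basis inE (negPf kI) (negPf kJ) scaler0.
Qed.

Lemma interior_wedge k p a b : homogeneous p a ->
  interior (delta_mx 0 k) (wedge a b) =
  wedge (interior (delta_mx 0 k) a) b +
  (-1) ^+ p *: wedge a (interior (delta_mx 0 k) b).
Proof.
move=> ha; rewrite (ext_decomp a) !wedge_suml !linear_sum wedge_suml /=.
rewrite -big_split; apply: eq_bigr => I _ /=.
have [->|/ha <-] := eqVneq (a I) 0.
  by rewrite !(scale0r, linear0, wedge0l, add0r, scaler0).
rewrite (ext_decomp b) !linear_sum /=.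
rewrite -big_split; apply: eq_bigr => J _ /=.
rewrite !(wedgeZl, wedgeZr, linearZ) /= ?(wedgeZl, wedgeZr).
rewrite interior_wedge_basis !scalerDr; congr (_ + _).
Qed.

Variable br : 'rV[F]_m -> 'rV[F]_m -> 'rV[F]_m.

Lemma wedge_ce_d1C xi b : wedge (ce_d1 br xi) b = wedge b (ce_d1 br xi).
Proof.
rewrite /ce_d1 !(wedge_suml, wedge_sumr); apply: eq_bigr => i _.
rewrite !(wedge_suml, wedge_sumr); apply: eq_bigr => j ltij.
rewrite wedgeZl wedgeZr; congr (_ *: _).
rewrite wedge_basis disjoints1 inE neq_ltn ltij.
by rewrite wedgeZl wedgeZr wedgeC_even // cardsU1 inE neq_ltn ltij cards1.
Qed.

Lemma ce_d_leibniz p a b : homogeneous p a ->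
  ce_d br (wedge a b) = wedge (ce_d br a) b + (-1) ^+ p *: wedge a (ce_d br b).
Proof.
move=> ha; rewrite /ce_d wedge_suml wedge_sumr scaler_sumr -big_split /=.
apply: eq_bigr => k _; rewrite (interior_wedge _ _ ha) raddfD /= wedgeA.
congr (_ + _); rewrite wedgeZr; congr (_ *: _).
by rewrite !wedgeA wedge_ce_d1C.
Qed.

Lemma interior_covec k xi :
  interior (delta_mx 0 k) (covec xi) = xi 0 k *: ext1 F m.
Proof.
rewrite linear_sum (bigD1 k) //= big1 ?addr0 => [|i nik]; last first.
  by rewrite linearZ /= interior_basis inE eq_sym (negPf nik) scaler0.
rewrite linearZ /= interior_basis set11 setDv /wsign.
by rewrite big1 ?scale1r // => i _; rewrite big_set0.
Qed.

Lemma wedge1r a : wedge a (ext1 F m) = a.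
Proof.
rewrite [RHS]ext_decomp {1}(ext_decomp a) wedge_suml; apply: eq_bigr => I _.
rewrite wedgeZl wedge_basis disjoint_sym disjoints_subset sub0set setU0.
by rewrite [w I _]big1 ?scale1r // => i _; rewrite big_set0.
Qed.

Lemma ce_d_covec xi : ce_d br (covec xi) = ce_d1 br xi.
Proof.
rewrite /ce_d; under eq_bigr do rewrite interior_covec wedgeZr wedge1r.
under eq_bigr do rewrite scaler_sumr; rewrite exchange_big; apply: eq_bigr => i _.
under eq_bigr do rewrite scaler_sumr; rewrite exchange_big; apply: eq_bigr => j _.
rewrite /= [dual_ev xi _]/dual_ev -sumrN scaler_suml; apply: eq_bigr => k _.
rewrite scalerA mulrN; congr (- (_ * _) *: _).
rewrite /dual_ev (bigD1 k) //= big1 ?addr0 => [|l nlk].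
  by rewrite mxE !eqxx mul1r.
by rewrite mxE (negPf nlk) andbF mul0r.
Qed.

End Derivation.

(** * Invariant generalized complex structures *)

Local Notation toC := (real_complex _).

Section GeneralizedComplex.
Variables (R : realType) (m : nat).
(* The C-bilinear extension of the bracket of a real Lie algebra on R^m. *)
Variables (brC : 'rV[R[i]]_m -> 'rV[R[i]]_m -> 'rV[R[i]]_m).
Implicit Types (J : 'M[R]_(m + m)) (rho : ext R[i] m).

(* The 'i-eigenspace L of J, as the row space of a matrix. *)
Definition gcs_eigen J : 'M[R[i]]_(m + m) := eigenspace (map_mx toC J) 'i.

Definition is_gcs J : Prop :=
  [/\ J *m J = - 1%:M,
      forall u v : 'rV[R]_(m + m), gpair (u *m J) (v *m J) = gpair u v
    & forall u v : 'rV[R[i]]_(m + m),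
        (u <= gcs_eigen J)%MS -> (v <= gcs_eigen J)%MS ->
        (courant brC u v <= gcs_eigen J)%MS].

(* rho spans the line K_L whose annihilator is L. *)
Definition spinor_generator J rho : Prop :=
  rho != 0 /\
  forall u : 'rV[R[i]]_(m + m), (u <= gcs_eigen J)%MS <-> clifford u rho = 0.

Definition complexify (a : ext R m) : ext R[i] m := [ffun I => (a I)%:C%C].

Definition ext_conj rho : ext R[i] m := [ffun I => (rho I)^*].

(* rho = exp(B + i omega) /\ Omega with Omega = theta_1 /\ ... /\ theta_k,  *)
(* where dim g = m = 2n.  The constant c is Omega when k = 0; when k > 0 it   *)
(* can be absorbed in the theta_i.                                            *)
Definition spinor_of_type (k : nat) rho : Prop :=
  exists (B omega : ext R m) (theta : 'M[R[i]]_(k, m)) (c : R[i]),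
  let Omega := c *: wedge_rows theta in
  [/\ homogeneous 2 B /\ homogeneous 2 omega,
      row_free theta /\ c != 0,
      rho = wedge (wedge_exp (complexify B + 'i *: complexify omega)) Omega
    & wedge (wedge_pow (complexify omega) (m./2 - k))
            (wedge Omega (ext_conj Omega)) != 0].

Definition gcs_of_type (k : nat) J : Prop :=
  exists2 rho, spinor_generator J rho & spinor_of_type k rho.

Definition has_closed_generator J : Prop :=
  exists2 rho, spinor_generator J rho & ce_d brC rho = 0.

End GeneralizedComplex.

(** * The Lie algebra R e_0 |x_A R^p and the conditions on the spectrum of A *)

(* The first coordinate is that of e_0, the others form the ideal F^p, and    *)
(* [e_0, v] = A v; v is a row vector, so that A v is v *m A^T.  Over an       *)
(* extension field this is the extension of scalars of the same bracket.      *)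
Definition semidirect_bracket (F : fieldType) (p : nat) (A : 'M[F]_p)
    (X Y : 'rV[F]_(1 + p)) : 'rV[F]_(1 + p) :=
  row_mx 0 (lsubmx X 0 0 *: (rsubmx Y *m A^T)
            - lsubmx Y 0 0 *: (rsubmx X *m A^T)).

(* The multiset of the roots of char_poly A, with multiplicities; multisets   *)
(* are sequences up to perm_eq.                                               *)
Definition is_spectrum (F : fieldType) (p : nat) (A : 'M[F]_p) (s : seq F) :=
  char_poly A = \prod_(x <- s) ('X - x%:P).

Definition two_identical_pairs (F : fieldType) (s : seq F) : Prop :=
  exists r t u, perm_eq s [:: r, r, t, t & u].

Definition two_opposite_pairs (F : fieldType) (s : seq F) : Prop :=
  exists r t u, perm_eq s [:: r, - r, t, - t & u].

(* Main.v *)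
From HB Require Import structures.
Require Import Defs.
From mathcomp Require Import all_boot all_order all_algebra.
From mathcomp Require Import reals.
From mathcomp Require Import complex.
Import GRing.Theory Num.Theory.
Local Open Scope ring_scope.
Set Implicit Arguments.
Unset Strict Implicit.
Unset Printing Implicit Defensive.

(** On R e_0 |x_A R^5 with A diagonal, d e^I = - wt(I) e^0 /\ e^I, where wt(I)
    is the sum over I of the eigenvalues mu_i of A (and mu_0 = 0).  So a closed
    form is one whose restriction to the ideal R^5 has only components of
    weight 0 ([ce_d_eq0_weightless]); such forms are called weightless below.

    A closed generator is a multiple of exp(a) /\ Omega, with a = B + i omega,
    because the annihilator determines the spinor up to a scalar
    ([pure_spinor_unique]).  Taking the components of degree k and k + 2,
    Omega and a /\ Omega are weightless ([weightless_components]); hence on the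
    ideal a can be replaced by its part of weight 0 in a /\ Omega
    ([restr_weight0_wedge]).  The aim is to turn the nondegeneracy
    omega^(3-k) /\ Omega /\ conj Omega != 0 into a product x /\ y /\ z that does
    not vanish on the ideal, where x and y are weightless 2-forms.  A nonzero
    component of it provides disjoint pairs {i, j} and {k, l} with
    mu_i + mu_j = 0 = mu_k + mu_l ([weight_pairs]): two opposite pairs.

    By linear algebra ([e0_dichotomy]) there are two positions of e^0 relative
    to the theta_i and their conjugates.
    - Some vector v with e^0(v) = 1 is killed by all of them.  Then
      Omega /\ conj Omega (k = 2) or omega /\ theta /\ conj theta (k = 1) does
      not vanish on the ideal ([restr_neq0_transversal] and
      [restr_wedge_neq0_transversal]), and it has the required form once omega
      is replaced by its part of weight 0.
    - Otherwise e^0 = T + conj T with T a combination of the theta_i.  On the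
      ideal conj T = - T, so the relations for a /\ Omega and for their
      conjugates concern the same factor T and can be subtracted to give a
      relation for omega.  The surviving product is omega /\ omega /\ T for
      k = 1; for k = 2 it is omega /\ (T /\ K) /\ conj K, where
      Omega = T /\ K. *)

Local Notation "a *w b" := (wedge a b) (at level 40, left associativity).

(** * Wedge and interior products *)

Section Wedge.
Variables (F : numFieldType) (m : nat).
Implicit Types (I J K : {set 'I_m}) (X Y xi eta : 'rV[F]_m) (a b c : ext F m).

Lemma wedge1l a : ext1 F m *w a = a.
Proof. by rewrite wedgeC_even ?cards0 // wedge1r. Qed.

Lemma wedgeDl a b c : (a + b) *w c = a *w c + b *w c.
Proof. exact: (raddfD (wedger c)). Qed.

Lemma wedgeNl a b : (- a) *w b = - (a *w b).
Proof. exact: (raddfN (wedger b)). Qed.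

Lemma wedgeNr a b : a *w (- b) = - (a *w b).
Proof. exact: raddfN. Qed.

Lemma wedge_neq0 a b K : (a *w b) K != 0 ->
  exists2 I : {set 'I_m}, I \subset K & (a I != 0) && (b (K :\: I) != 0).
Proof.
rewrite ffunE => h.
have [I /andP[sIK]] : exists I : {set 'I_m},
    (I \subset K) && (wsign F I (K :\: I) * a I * b (K :\: I) != 0).
  apply/existsP; apply: contraNT h; rewrite negb_exists => /forallP h.
  rewrite big1 // => I sIK; move: (h I); rewrite sIK /= negbK.
  by move/eqP.
rewrite !mulf_eq0 !negb_or => /andP[/andP[_ ha] hb].
by exists I => //; rewrite ha.
Qed.

Lemma homogeneous_wedge p q a b :
  homogeneous p a -> homogeneous q b -> homogeneous (p + q) (a *w b).
Proof.
move=> ha hb K /wedge_neq0[I sIK /andP[/ha <- /hb <-]].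
by rewrite -(cardsID I K) (setIidPr sIK).
Qed.

Lemma homogeneous_ext1 : homogeneous 0 (ext1 F m).
Proof.
move=> I; rewrite ffunE; have [->|_] := eqVneq I set0; rewrite ?cards0 //.
by rewrite eqxx.
Qed.

Lemma homogeneousD p a b :
  homogeneous p a -> homogeneous p b -> homogeneous p (a + b).
Proof.
move=> ha hb I; rewrite ext_addE; have [->|/ha //] := eqVneq (a I) 0.
by rewrite add0r => /hb.
Qed.

Lemma homogeneousZ p t a : homogeneous p a -> homogeneous p (t *: a).
Proof. by move=> ha I; rewrite ext_scaleE mulf_eq0 => /norP[_ /ha]. Qed.

Lemma homogeneous_large p a : homogeneous p a -> (m < p)%N -> a = 0.
Proof.
move=> ha lt_mp; apply/ffunP => I; rewrite [RHS]ffunE.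
apply/eqP; apply: contraLR lt_mp => /ha <-.
by rewrite -leqNgt -[m in (_ <= m)%N]card_ord max_card.
Qed.

(** Exponentials of 2-forms are not homogeneous, but even forms are still
    central and differentiated by contractions without signs. *)
Definition even_form a := forall I, odd #|I| -> a I = 0.

Lemma even_form_homogeneous p a : ~~ odd p -> homogeneous p a -> even_form a.
Proof.
by move=> evp ha I; apply: contraTeq => /ha ->.
Qed.

Lemma even_form_sum (T : Type) (s : seq T) (f : T -> ext F m) :
  (forall i, even_form (f i)) -> even_form (\sum_(i <- s) f i).
Proof. by move=> hf I oI; rewrite ext_sumE big1 // => i _; apply: hf. Qed.

Lemma even_formZ t a : even_form a -> even_form (t *: a).
Proof. by move=> ha I oI; rewrite ext_scaleE ha ?mulr0. Qed.

Lemma wedgeC_even_form a b : even_form a -> a *w b = b *w a.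
Proof.
move=> ha; rewrite (ext_decomp a) wedge_suml wedge_sumr.
apply: eq_bigr => I _; rewrite wedgeZl wedgeZr.
have [/ha ->|oI] := boolP (odd #|I|); first by rewrite !scale0r.
by rewrite wedgeC_even.
Qed.

Lemma wedgeCA_even_form a b c : even_form a -> a *w (b *w c) = b *w (a *w c).
Proof. by move=> ha; rewrite !wedgeA (wedgeC_even_form b ha). Qed.

Lemma interior_sumE X a : interior X a = \sum_i X 0 i *: interior (delta_mx 0 i) a.
Proof.
apply/ffunP => K; rewrite ext_sumE ffunE big_mkcond /=; apply: eq_bigr => i _.
rewrite ext_scaleE ffunE; case: ifPn => iK.
  rewrite (bigD1 i) //= big1 ?addr0 => [|j /andP[_ nji]].
    by rewrite mxE !eqxx mulr1 mulrCA !mulrA.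
  by rewrite mxE (negPf nji) andbF mulr0 mul0r.
rewrite big1 ?mulr0 // => j jK; rewrite mxE.
have [eji|_] := eqVneq j i; last by rewrite andbF mulr0 mul0r.
by rewrite -eji jK in iK.
Qed.

Lemma interiorDl X Y a : interior (X + Y) a = interior X a + interior Y a.
Proof.
rewrite !(interior_sumE _ a) -big_split; apply: eq_bigr => i _ /=.
by rewrite mxE scalerDl.
Qed.

Lemma interiorZl t X a : interior (t *: X) a = t *: interior X a.
Proof.
rewrite !(interior_sumE _ a) scaler_sumr; apply: eq_bigr => i _ /=.
by rewrite mxE scalerA.
Qed.

Lemma interior_wedge_hom X p a b : homogeneous p a ->
  interior X (a *w b) = interior X a *w b + (-1) ^+ p *: (a *w interior X b).
Proof.
move=> ha; rewrite !(interior_sumE X) wedge_suml wedge_sumr scaler_sumr.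
rewrite -big_split /=; apply: eq_bigr => i _.
rewrite (interior_wedge _ _ ha) scalerDr wedgeZl wedgeZr !scalerA.
by rewrite [_ * (-1) ^+ _]mulrC.
Qed.

Lemma homogeneous_ebasis I : homogeneous #|I| (ebasis F I).
Proof. by move=> J; rewrite ffunE; have [->|_] := eqVneq J I; rewrite ?eqxx. Qed.

Lemma interior_wedge_even X a b : even_form a ->
  interior X (a *w b) = interior X a *w b + a *w interior X b.
Proof.
move=> ha; rewrite (ext_decomp a) !wedge_suml !linear_sum !wedge_suml -big_split.
apply: eq_bigr => I _ /=; rewrite !wedgeZl !linearZ /= wedgeZl -scalerDr.
have [/ha ->|oI] := boolP (odd #|I|); first by rewrite !scale0r.
rewrite (interior_wedge_hom _ _ (@homogeneous_ebasis I)).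
by rewrite -signr_odd (negPf oI) expr0 scale1r.
Qed.

Lemma homogeneous_covec xi : homogeneous 1 (covec xi).
Proof.
move=> I; apply: contraNeq => nI; rewrite ext_sumE big1 // => i _.
rewrite ext_scaleE ffunE; have [eI|_] := eqVneq I [set i]; last by rewrite mulr0.
by rewrite eI cards1 in nI.
Qed.

Lemma interior_covecE X xi : interior X (covec xi) = dual_ev xi X *: ext1 F m.
Proof.
rewrite interior_sumE scaler_suml; apply: eq_bigr => i _.
by rewrite interior_covec scalerA mulrC.
Qed.

Lemma interior_covec_wedge X xi b : 
  interior X (covec xi *w b) = dual_ev xi X *: b - covec xi *w interior X b.
Proof.
rewrite (interior_wedge_hom _ _ (@homogeneous_covec xi)) interior_covecE.
by rewrite wedgeZl wedge1l expr1 scaleN1r.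
Qed.

Lemma interior_basisC i j I :
  interior (delta_mx 0 i) (interior (delta_mx 0 j) (ebasis F I)) =
  - interior (delta_mx 0 j) (interior (delta_mx 0 i) (ebasis F I)).
Proof.
rewrite !interior_basis.
have [->|nij] := eqVneq i j.
  case: ifP => _; rewrite ?linear0 ?oppr0 // linearZ /= interior_basis.
  by rewrite !inE eqxx /= scaler0 oppr0.
have nji : j != i by rewrite eq_sym.
case: ifPn => jI; case: ifPn => iI; rewrite ?linear0 ?oppr0 // ?linearZ /= ?interior_basis.
- rewrite !inE nij nji iI jI /=.
  have -> : I :\ i :\ j = I :\ j :\ i by rewrite !setDDl setUC.
  have hi : i \in I :\ j by rewrite !inE nij.
  have hj : j \in I :\ i by rewrite !inE nji.
  rewrite (wsign_split F [set j] hi).2 (wsign_split F [set i] hj).2.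
  have -> : I :\ i :\ j = I :\ j :\ i by rewrite !setDDl setUC.
  have := @wsignC F m [set i] [set j]; rewrite disjoints1 inE => /(_ nij).
  rewrite !cards1 muln1 expr1 => wC.
  have -> : wsign F [set i] [set j] = - wsign F [set j] [set i].
    by rewrite -[LHS]mulr1 -(wsign_sq F [set j] [set i]) mulrA wC mulN1r.
  rewrite !scalerA -scaleNr !scalerA mulrN !mulNr opprK.
  by congr (_ *: _); rewrite -!mulrA; congr (_ * _); rewrite mulrC.
- by rewrite !inE (negPf iI) andbF scaler0.
- by rewrite !inE (negPf jI) andbF oppr0 scaler0.
Qed.

Lemma interiorC X Y a : interior X (interior Y a) = - interior Y (interior X a).
Proof.
have basisC i j b : interior (delta_mx 0 i) (interior (delta_mx 0 j) b) =
    - interior (delta_mx 0 j) (interior (delta_mx 0 i) b).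
  rewrite (ext_decomp b) !linear_sum; apply: eq_bigr => I _ /=.
  by rewrite !linearZ /= interior_basisC scalerN.
rewrite (interior_sumE Y (interior X a)) (interior_sumE Y a) linear_sum -sumrN.
apply: eq_bigr => j _; rewrite linearZ /= -scalerN; congr (_ *: _).
rewrite !(interior_sumE X) linear_sum -sumrN; apply: eq_bigr => i _ /=.
by rewrite linearZ /= basisC scalerN.
Qed.

Lemma interior_sq X a : interior X (interior X a) = 0.
Proof.
have := interiorC X X a => /eqP; rewrite -subr_eq0 opprK -mulr2n -scaler_nat.
by rewrite scaler_eq0 pnatr_eq0 => /eqP.
Qed.

(** A nonzero coefficient a_I with i in I reappears, up to sign, as the
    coefficient of I minus i in the contraction by e_i. *)
Lemma interior_eq0_const a : (forall X, interior X a = 0) -> a = a set0 *: ext1 F m.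
Proof.
move=> ha; rewrite {1}(ext_decomp a) (bigD1 set0) //= big1 ?addr0 // => I.
case/set0Pn => i iI; apply/eqP; rewrite scaler_eq0; apply/orP; left.
move/ffunP/(_ (I :\ i)): (ha (delta_mx 0 i)).
rewrite ffunE (bigD1 i) ?setD11 //= big1 ?addr0 => [|j /andP[_ nji]].
  rewrite mxE !eqxx mulr1 setD1K // [RHS]ffunE => /eqP; rewrite mulf_eq0.
  case/orP => // /eqP w0; move: (wsign_sq F [set i] (I :\ i)).
  by rewrite w0 mulr0 => /esym/eqP; rewrite oner_eq0.
by rewrite mxE (negPf nji) andbF mulr0 mul0r.
Qed.

Lemma covecD xi eta : covec (xi + eta) = covec xi + covec eta.
Proof.
by rewrite -big_split; apply: eq_bigr => i _ /=; rewrite mxE scalerDl.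
Qed.

Lemma covecZ t xi : covec (t *: xi) = t *: covec xi.
Proof. by rewrite scaler_sumr; apply: eq_bigr => i _; rewrite mxE scalerA. Qed.

Lemma covec_delta i : covec (delta_mx 0 i) = @ebasis F m [set i].
Proof.
rewrite /covec (bigD1 i) //= big1 ?addr0 => [|j nji]; rewrite mxE.
  by rewrite !eqxx scale1r.
by rewrite (negPf nji) andbF scale0r.
Qed.

Lemma covec_set1 xi i : covec xi [set i] = xi 0 i.
Proof.
rewrite ext_sumE (bigD1 i) //= big1 ?addr0 => [|j nji].
  by rewrite ext_scaleE ffunE eqxx mulr1.
rewrite ext_scaleE ffunE; have [/set1_inj eij|_] := eqVneq [set i] [set j].
  by rewrite eij eqxx in nji.
by rewrite mulr0.
Qed.

Lemma homogeneous1_covec a : homogeneous 1 a -> a = covec (\row_i a [set i]).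
Proof.
move=> ha; apply/ffunP => I; have [/cards1P[i ->]|nI] := boolP (#|I| == 1%N).
  by rewrite covec_set1 mxE.
have [->|/ha/eqP] := eqVneq (a I) 0; last by rewrite (negPf nI).
apply/esym/eqP; apply: contraNT nI.
by move/homogeneous_covec ->.
Qed.

Lemma covecC xi eta : covec xi *w covec eta = - (covec eta *w covec xi).
Proof.
rewrite [in LHS]/covec [in RHS]/covec.
rewrite (wedge_suml _ _ _ (covec eta)) (wedge_sumr _ _ (covec eta)) -sumrN.
apply: eq_bigr => i _; rewrite wedgeZl wedgeZr -scalerN; congr (_ *: _).
rewrite wedge_sumr wedge_suml -sumrN; apply: eq_bigr => j _.
rewrite wedgeZl wedgeZr -scalerN; congr (_ *: _).
rewrite !wedge_basis !disjoints1 !inE [j == i]eq_sym.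
have [//|nij] := eqVneq i j; first by rewrite oppr0.
have := @wsignC F m [set i] [set j]; rewrite disjoints1 inE => /(_ nij).
rewrite !cards1 muln1 expr1 => wC.
rewrite setUC -scaleNr; congr (_ *: _).
by rewrite -[LHS]mulr1 -(wsign_sq F [set j] [set i]) mulrA wC mulN1r.
Qed.

Lemma covec_sq xi : covec xi *w covec xi = 0.
Proof.
have /eqP := covecC xi xi; rewrite -subr_eq0 opprK -mulr2n -scaler_nat.
by rewrite scaler_eq0 pnatr_eq0 => /eqP.
Qed.

Lemma covecCA xi eta a :
  covec xi *w (covec eta *w a) = - (covec eta *w (covec xi *w a)).
Proof. by rewrite wedgeA covecC wedgeNl wedgeA. Qed.

Lemma covec_sqA xi a : covec xi *w (covec xi *w a) = 0.
Proof. by rewrite wedgeA covec_sq wedge0l. Qed.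

Lemma homogeneous_interior X p a :
  homogeneous p.+1 a -> homogeneous p (interior X a).
Proof.
move=> ha K; rewrite ffunE => h; apply/eqP; apply: contraNT h => nK.
apply/eqP/big1 => i iK; apply/eqP; rewrite mulf_eq0; apply/orP; right.
by apply: contraNT nK => /ha; rewrite cardsU1 iK add1n => -[->].
Qed.

End Wedge.

(** * Exponentials and uniqueness of pure spinors *)

Section PureSpinor.
Variables (F : numFieldType) (m : nat).
Implicit Types (I J K : {set 'I_m}) (X Y xi eta : 'rV[F]_m) (a b rho sigma : ext F m).

Lemma wedge_powS a j : wedge_pow a j.+1 = a *w wedge_pow a j.
Proof. by []. Qed.

Lemma homogeneous_wedge_pow a j :
  homogeneous 2 a -> homogeneous j.*2 (wedge_pow a j).
Proof.
move=> ha; elim: j => [|j IHj]; first exact: homogeneous_ext1.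
by rewrite doubleS -add2n; apply: homogeneous_wedge.
Qed.

Lemma even_form_exp a : homogeneous 2 a -> even_form (wedge_exp a).
Proof.
move=> ha; apply: even_form_sum => j; apply: even_formZ.
apply: (@even_form_homogeneous _ _ j.*2); last exact: homogeneous_wedge_pow.
by rewrite odd_double.
Qed.

Lemma interior_wedge_pow X a j : homogeneous 2 a ->
  interior X (wedge_pow a j.+1) = j.+1%:R *: (interior X a *w wedge_pow a j).
Proof.
move=> ha; have eva : even_form a by apply: even_form_homogeneous ha.
elim: j => [|j IHj].
  rewrite /wedge_pow /= wedge1r scale1r.
  by rewrite wedge1r.
rewrite wedge_powS (interior_wedge_even _ _ eva) IHj wedgeZr.
rewrite (wedgeCA_even_form _ _ eva) -wedge_powS -[X in X + _]scale1r -scalerDl.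
by rewrite nat1r.
Qed.

(** Contractions act on the even subalgebra as derivations, hence the usual rule
    for an exponential; the truncation is harmless, as a^m = 0 for m > 0. *)
Lemma interior_exp X a : homogeneous 2 a ->
  interior X (wedge_exp a) = interior X a *w wedge_exp a.
Proof.
move=> ha; have [m0|m_gt0] := posnP m.
  have X0 b : interior X b = 0.
    by rewrite interior_sumE big1 // => i; have := ltn_ord i; rewrite {2}m0.
  by rewrite !X0 wedge0l.
rewrite /wedge_exp [in LHS]big_ord_recl [in RHS]big_ord_recr /=.
have -> : wedge_pow a m = 0.
  apply: (homogeneous_large (homogeneous_wedge_pow ha)).
  by rewrite -addnn -[m in (m < _)%N]addn0 ltn_add2l.
rewrite scaler0 addr0 !linearD linearZ /=.
have -> : interior X (wedge_pow a 0) = 0.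
  rewrite interior_sumE big1 // => i _.
  by rewrite interior_basis inE scaler0.
rewrite scaler0 add0r !linear_sum; apply: eq_bigr => j _.
rewrite linearZ /= -wedge_powS (interior_wedge_pow _ _ ha) scalerA wedgeZr.
congr (_ *: _); rewrite factS natrM invfM mulrAC mulVf ?mul1r //.
by rewrite pnatr_eq0.
Qed.

Lemma wedge_exp0 a : homogeneous 2 a -> wedge_exp a set0 = 1.
Proof.
move=> ha; rewrite ext_sumE big_ord_recl big1 => [|j _].
  by rewrite ext_scaleE ffunE eqxx invr1 !mulr1 addr0.
rewrite ext_scaleE; have [->|] := eqVneq (wedge_pow a (lift ord0 j) set0) 0.
  by rewrite mulr0.
by move/(homogeneous_wedge_pow ha); rewrite cards0.
Qed.

Lemma wedge_set0 a b : (a *w b) set0 = a set0 * b set0.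
Proof.
rewrite ffunE (bigD1 set0) //= big1 ?addr0 => [|I /andP[]].
  rewrite set0D /wsign big1 ?mul1r // => i.
  by rewrite inE.
by rewrite subset0 => ->.
Qed.

(** The product is killed by all contractions, hence constant, and its constant
    term is 1. *)
Lemma wedge_expN a : homogeneous 2 a -> wedge_exp a *w wedge_exp (- a) = ext1 F m.
Proof.
move=> ha; have hna : homogeneous 2 (- a) by rewrite -scaleN1r; apply: homogeneousZ.
rewrite [LHS]interior_eq0_const => [|X].
  by rewrite wedge_set0 !wedge_exp0 // mulr1 scale1r.
rewrite (interior_wedge_even _ _ (even_form_exp ha)) !interior_exp //.
rewrite (wedgeCA_even_form _ _ (even_form_exp ha)) wedgeA linearN /= wedgeNl.
by rewrite wedgeNl subrr.
Qed.

(** The form of [wedge_rows], for a family in place of a matrix: removing the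
    first covector is then a mere reindexing. *)
Definition wedge_family k (t : 'I_k -> 'rV[F]_m) : ext F m :=
  \big[@wedge F m/ext1 F m]_(i < k) covec (t i).

Lemma wedge_familyS k (t : 'I_k.+1 -> 'rV[F]_m) :
  wedge_family t = covec (t ord0) *w wedge_family (fun i => t (lift ord0 i)).
Proof. by rewrite /wedge_family big_ord_recl. Qed.

Lemma homogeneous_wedge_family k (t : 'I_k -> 'rV[F]_m) :
  homogeneous k (wedge_family t).
Proof.
elim: k t => [|k IHk] t; first by rewrite /wedge_family big_ord0; apply: homogeneous_ext1.
by rewrite wedge_familyS; apply: (@homogeneous_wedge _ _ 1%N) (IHk _); apply: homogeneous_covec.
Qed.

Lemma covec_wedge_family k (t : 'I_k -> 'rV[F]_m) i :
  covec (t i) *w wedge_family t = 0.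
Proof.
elim: k t i => [|k IHk] t i; first by case: i.
rewrite wedge_familyS; have [j ->|->] := unliftP ord0 i.
  by rewrite covecCA (IHk (fun i => t (lift ord0 i))) wedge0r oppr0.
by rewrite covec_sqA.
Qed.

Lemma interior_wedge_family k (t : 'I_k -> 'rV[F]_m) X :
  (forall i, dual_ev (t i) X = 0) -> interior X (wedge_family t) = 0.
Proof.
elim: k t => [|k IHk] t ht.
  rewrite /wedge_family big_ord0 interior_sumE big1 // => i _.
  by rewrite interior_basis inE scaler0.
rewrite wedge_familyS interior_covec_wedge ht scale0r IHk ?wedge0r ?subr0 //.
Qed.

Lemma dual_evDr xi X Y : dual_ev xi (X + Y) = dual_ev xi X + dual_ev xi Y.
Proof. by rewrite -big_split; apply: eq_bigr => i _ /=; rewrite mxE mulrDr. Qed.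

Lemma dual_evZr t xi X : dual_ev xi (t *: X) = t * dual_ev xi X.
Proof. by rewrite mulr_sumr; apply: eq_bigr => i _ /=; rewrite mxE mulrCA. Qed.

Lemma dual_ev_delta (i : 'I_m) X : dual_ev (delta_mx 0 i) X = X 0 i.
Proof.
rewrite /dual_ev (bigD1 i) //= big1 ?addr0 => [|l nli]; rewrite mxE.
  by rewrite !eqxx mul1r.
by rewrite (negPf nli) andbF mul0r.
Qed.

(** With v dual to t_0, the relation t_0 /\ sigma = 0 contracted by v gives
    sigma = t_0 /\ (i_v sigma), and i_v sigma satisfies the same hypotheses for
    the remaining covectors; the induction ends with a form killed by all
    contractions, that is, a constant. *)
Lemma wedge_family_unique k (t V : 'I_k -> 'rV[F]_m) sigma :
    (forall i j, dual_ev (t i) (V j) = (i == j)%:R) ->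
    (forall i, covec (t i) *w sigma = 0) ->
    (forall X, (forall i, dual_ev (t i) X = 0) -> interior X sigma = 0) ->
  exists c, sigma = c *: wedge_family t.
Proof.
elim: k t V sigma => [|k IHk] t V sigma tV t_sigma X_sigma.
  exists (sigma set0); rewrite /wedge_family big_ord0.
  by apply: interior_eq0_const => X; apply: X_sigma => -[].
pose v := V ord0; pose sigma1 := interior v sigma.
have ev0 : dual_ev (t ord0) v = 1 by rewrite tV eqxx.
have evS i : dual_ev (t (lift ord0 i)) v = 0 by rewrite tV.
have ct i : interior v (covec (t i) *w sigma) = 0 by rewrite t_sigma linear0.
have def_sigma : sigma = covec (t ord0) *w sigma1.
  have := ct ord0; rewrite interior_covec_wedge ev0 scale1r => /eqP.
  by rewrite subr_eq0 => /eqP.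
have [i|i|X tX|c def_sigma1] := IHk (fun i => t (lift ord0 i)) (fun i => V (lift ord0 i)) sigma1.
- by move=> j; rewrite tV (inj_eq lift_inj).
- have := ct (lift ord0 i); rewrite interior_covec_wedge evS scale0r sub0r.
  by move/eqP; rewrite oppr_eq0 => /eqP.
- have : interior (X - dual_ev (t ord0) X *: v) sigma = 0.
    apply: X_sigma => i; rewrite dual_evDr -scaleNr dual_evZr.
    have [j ->|->] := unliftP ord0 i; first by rewrite tX evS mulr0 addr0.
    by rewrite ev0 mulr1 addrC addNr.
  rewrite interiorDl -scaleNr interiorZl scaleNr => /eqP.
  rewrite subr_eq0 => /eqP eX.
  by rewrite /sigma1 interiorC eX linearZ /= interior_sq scaler0 oppr0.
by exists c; rewrite def_sigma def_sigma1 wedgeZr -wedge_familyS.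
Qed.

Lemma row_free_dual k (theta : 'M[F]_(k, m)) : row_free theta ->
  exists V : 'I_k -> 'rV[F]_m,
    forall i j, dual_ev (row i theta) (V j) = (i == j)%:R.
Proof.
case/row_freeP => N thetaN; exists (fun j => (col j N)^T) => i j.
move/matrixP/(_ i j): thetaN; rewrite !mxE => <-.
by apply: eq_bigr => l _; rewrite !mxE.
Qed.

Lemma wedge_rowsE k (theta : 'M[F]_(k, m)) :
  wedge_rows theta = wedge_family (fun i => row i theta).
Proof. by []. Qed.

(** The annihilator of exp(a) /\ theta_1 /\ ... /\ theta_k contains the theta_i
    and X - i_X a for the vectors X killed by the theta_i.  On exp(- a) /\ rho
    these become the operators theta_i /\ and i_X, and
    [wedge_family_unique] applies. *)
Lemma pure_spinor_unique a k (theta : 'M[F]_(k, m)) rho :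
    homogeneous 2 a -> row_free theta ->
    (forall u, clifford u (wedge_exp a *w wedge_rows theta) = 0 ->
               clifford u rho = 0) ->
  exists c, rho = c *: (wedge_exp a *w wedge_rows theta).
Proof.
move=> ha /row_free_dual[V thetaV] ann.
pose a' := - a; have ha' : homogeneous 2 a' by rewrite /a' -scaleN1r; apply: homogeneousZ.
have [eva eva'] := (even_form_exp ha, even_form_exp ha').
have theta_rho i : covec (row i theta) *w rho = 0.
  have := ann (row_mx 0 (row i theta)); rewrite /clifford row_mxKl row_mxKr.
  have int0 b : interior 0 b = 0.
    by rewrite interior_sumE big1 // => j _; rewrite mxE scale0r.
  rewrite !int0 !add0r; apply; rewrite -(wedgeCA_even_form _ _ eva) wedge_rowsE.
  by rewrite (covec_wedge_family (fun i => row i theta)) wedge0r.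
have X_rho X : (forall i, dual_ev (row i theta) X = 0) ->
    interior X rho = interior X a *w rho.
  move=> thetaX; pose xi : 'rV_m := \row_i (interior X a) [set i].
  have def_xi : interior X a = covec xi.
    by apply/homogeneous1_covec/homogeneous_interior.
  have := ann (row_mx X (- xi)); rewrite /clifford row_mxKl row_mxKr.
  rewrite -scaleN1r covecZ !wedgeZl !scaleN1r -def_xi.
  rewrite (interior_wedge_even _ _ eva) interior_exp // wedge_rowsE.
  rewrite interior_wedge_family // wedge0r addr0 wedgeA subrr => /(_ erefl)/eqP.
  by rewrite subr_eq0 => /eqP.
have [i|X thetaX|c def_c] :=
  @wedge_family_unique k (fun i => row i theta) V (wedge_exp a' *w rho) thetaV.
- by rewrite -(wedgeCA_even_form _ _ eva') theta_rho wedge0r.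
- rewrite (interior_wedge_even _ _ eva') interior_exp // X_rho //.
  rewrite (wedgeCA_even_form _ _ eva') linearN /= !wedgeNl -wedgeA.
  by rewrite addNr.
exists c; rewrite wedge_rowsE -wedgeZr -def_c wedgeA wedge_expN // wedge1l.
by [].
Qed.

(** The other terms a^l /\ Omega / l! of the series have other degrees. *)
Lemma wedge_exp_coef a Omega k j I : homogeneous 2 a -> homogeneous k Omega ->
    (j <= m)%N -> #|I| = (j.*2 + k)%N ->
  (wedge_exp a *w Omega) I = (j`!%:R)^-1 * (wedge_pow a j *w Omega) I.
Proof.
move=> ha hO le_jm cI; rewrite wedge_suml ext_sumE.
have lt_jm : (j < m.+1)%N by [].
rewrite (bigD1 (Ordinal lt_jm)) //= big1 ?addr0 => [|l nlj].
  by rewrite wedgeZl ext_scaleE.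
rewrite wedgeZl ext_scaleE.
have [->|] := eqVneq ((wedge_pow a l *w Omega) I) 0; first by rewrite mulr0.
move/(homogeneous_wedge (homogeneous_wedge_pow ha) hO); rewrite cI.
move/addIn/double_inj => ejl; case/eqP: nlj.
by apply/val_inj.
Qed.

End PureSpinor.

(** * Restriction to the ideal and weights *)

Section Restriction.
Variables (F : numFieldType) (m : nat) (i0 : 'I_m).
Implicit Types (I J K : {set 'I_m}) (v : 'rV[F]_m) (a b c x y z : ext F m).

(** Restriction of forms to the hyperplane e^{i0} = 0, kept in the exterior
    algebra of the whole space so that it becomes an endomorphism. *)
Definition restr a : ext F m := [ffun I : {set 'I_m} => if i0 \in I then 0 else a I].

Lemma restrE a I : restr a I = if i0 \in I then 0 else a I.
Proof. by rewrite ffunE. Qed.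

Lemma restr_is_linear : linear restr.
Proof.
move=> t a b; apply/ffunP => I; rewrite !(restrE, ext_addE, ext_scaleE).
by case: ifP; rewrite ?mulr0 ?addr0.
Qed.

HB.instance Definition _ :=
  GRing.isLinear.Build F (ext F m) (ext F m) *:%R restr restr_is_linear.

Lemma restr_wedge a b : restr (a *w b) = restr a *w restr b.
Proof.
apply/ffunP => K; rewrite restrE; have [iK|iK] := boolP (i0 \in K).
  apply/esym/eqP/negbNE/negP => /wedge_neq0[I _].
  rewrite !restrE inE iK andbT; case: (i0 \in I) => //=; rewrite ?eqxx //.
  by rewrite andbF.
rewrite !ffunE; apply: eq_bigr => I sIK; rewrite !restrE inE (negPf iK) andbF.
by have [/(subsetP sIK)|//] := boolP (i0 \in I); rewrite (negPf iK).
Qed.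

Lemma restr_neq0 a : restr a != 0 -> exists2 I : {set 'I_m}, i0 \notin I & a I != 0.
Proof.
move=> ha; have [I /andP[iI aI]|na] := pickP [pred I : {set 'I_m} | (i0 \notin I) && (a I != 0)].
  by exists I.
case/eqP: ha; apply/ffunP => I; rewrite restrE [RHS]ffunE.
by have := na I => /=; case: (i0 \in I) => //= /negbFE/eqP.
Qed.

Local Notation eps := (covec (delta_mx 0 i0 : 'rV[F]_m)).

Lemma restr_eps : restr eps = 0.
Proof.
rewrite covec_delta; apply/ffunP => I; rewrite restrE ffunE [RHS]ffunE.
by have [->|_] := eqVneq I [set i0]; rewrite ?set11 ?if_same.
Qed.

Lemma restr_eq0P a : restr a = 0 <-> eps *w a = 0.
Proof.
split=> ha.
  rewrite covec_delta (ext_decomp a) wedge_sumr big1 // => I _.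
  rewrite wedgeZr wedge_basis disjoints1.
  have [_|iI] := boolP (i0 \in I); first by rewrite scaler0.
  have -> : a I = restr a I by rewrite restrE (negPf iI).
  by rewrite ha ffunE scale0r.
have /(congr1 (interior (delta_mx 0 i0))) := ha.
rewrite interior_covec_wedge linear0.
rewrite dual_ev_delta mxE !eqxx scale1r => /(congr1 restr).
by rewrite linearB /= restr_wedge restr_eps wedge0l subr0 linear0.
Qed.

(** A form that vanishes on the hyperplane is divisible by e^{i0}. *)
Lemma restr_eq0_interior v a : dual_ev (delta_mx 0 i0) v = 1 -> restr a = 0 ->
  a = eps *w interior v a.
Proof.
move=> v1 /restr_eq0P/(congr1 (interior v)).
rewrite interior_covec_wedge linear0 v1 scale1r => /eqP.
by rewrite subr_eq0 => /eqP.
Qed.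

Variable mu : 'I_m -> F.

Definition weight I : F := \sum_(i in I) mu i.

(** When mu is the spectrum of A on the ideal e^{i0} = 0 of a semidirect product,
    this is closedness, see [ce_d_eq0_weightless]. *)
Definition weightless a := forall I, i0 \notin I -> a I != 0 -> weight I = 0.

Definition weight0 a : ext F m := [ffun I : {set 'I_m} => if weight I == 0 then a I else 0].

Lemma weight0E a I : weight0 a I = if weight I == 0 then a I else 0.
Proof. by rewrite ffunE. Qed.

Lemma weight0_is_linear : linear weight0.
Proof.
move=> t a b; apply/ffunP => I; rewrite !(weight0E, ext_addE, ext_scaleE).
by case: ifP; rewrite ?mulr0 ?addr0.
Qed.

HB.instance Definition _ :=
  GRing.isLinear.Build F (ext F m) (ext F m) *:%R weight0 weight0_is_linear.

Lemma weightless_weight0 a : weightless (weight0 a).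
Proof. by move=> I _; rewrite weight0E; case: ifP => [/eqP //|]; rewrite eqxx. Qed.

Lemma homogeneous_weight0 p a : homogeneous p a -> homogeneous p (weight0 a).
Proof. by move=> ha I; rewrite weight0E; case: ifP => _; [apply: ha|rewrite eqxx]. Qed.

Lemma weightD I K : I \subset K -> weight K = weight I + weight (K :\: I).
Proof.
move=> sIK; rewrite /weight (big_setID I) /=; congr (_ + _).
by apply: eq_bigl => i; rewrite (setIidPr sIK).
Qed.

Lemma weightlessD a b : weightless a -> weightless b -> weightless (a + b).
Proof.
move=> ha hb I iI; rewrite ext_addE; have [->|/(ha _ iI) //] := eqVneq (a I) 0.
by rewrite add0r => /hb; apply.
Qed.

Lemma weightlessZ t a : weightless a -> weightless (t *: a).
Proof. by move=> ha I iI; rewrite ext_scaleE mulf_eq0 => /norP[_ /ha]; apply. Qed.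

Lemma weightless_wedge a b : weightless a -> weightless b -> weightless (a *w b).
Proof.
move=> ha hb K iK /wedge_neq0[I sIK /andP[aI bI]].
rewrite (weightD sIK) (ha I) // ?(hb (K :\: I)) ?addr0 // ?inE ?(negPf iK) ?andbF //.
by apply: contra iK; apply: (subsetP sIK).
Qed.

(** Weights add up in products: a component of a of nonzero weight would
    contribute to a /\ x in the same nonzero weight, so it contributes nothing. *)
Lemma restr_weight0_wedge a x : weightless x -> weightless (a *w x) ->
  restr (a *w x) = restr (weight0 a *w x).
Proof.
move=> hx hax; apply/ffunP => K; rewrite !restrE; case: ifPn => // iK.
have [wK|wK] := eqVneq (weight K) 0; last first.
  have -> : (a *w x) K = 0 by apply: contraNeq wK => /(hax _ iK) ->.
  apply/esym; apply: contraNeq wK.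
  by move/(weightless_wedge (@weightless_weight0 a) hx iK) ->.
rewrite !ffunE; apply: eq_bigr => I sIK; rewrite weight0E.
have [->|xKI] := eqVneq (x (K :\: I)) 0; first by rewrite !mulr0.
have wKI : weight (K :\: I) = 0.
  by apply: hx xKI; rewrite inE (negPf iK) andbF.
by move: wK; rewrite (weightD sIK) wKI addr0 => ->; rewrite eqxx.
Qed.

Lemma weightless_wedge_comb t a b x :
  weightless (a *w x) -> weightless (b *w x) -> weightless ((t *: (a - b)) *w x).
Proof.
move=> ha hb; rewrite wedgeZl wedgeDl wedgeNl -scaleN1r.
by apply/weightlessZ/weightlessD => //; apply: weightlessZ.
Qed.

Lemma restr_weight0_comb t a b x :
    restr (a *w x) = restr (weight0 a *w x) ->
    restr (b *w x) = restr (weight0 b *w x) ->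
  restr ((t *: (a - b)) *w x) = restr (weight0 (t *: (a - b)) *w x).
Proof.
move=> ha hb; rewrite [weight0 _]linearZ /= [weight0 _]linearB /= !wedgeZl.
rewrite [restr _]linearZ [in RHS]linearZ /=.
by rewrite !wedgeDl !wedgeNl !linearB /= ha hb.
Qed.

(** A nonzero component of the product is a product of nonzero components
    x_I, y_J and z_K with I, J, K disjoint, and I and J have weight 0. *)
Lemma weight_pairs x y z : homogeneous 2 x -> homogeneous 2 y ->
    weightless x -> weightless y -> restr (x *w (y *w z)) != 0 ->
  exists i j k l, [/\ uniq [:: i0; i; j; k; l], mu i + mu j = 0 & mu k + mu l = 0].
Proof.
move=> hx hy wx wy /restr_neq0[K iK /wedge_neq0[I sIK /andP[xI]]].
case/wedge_neq0 => J sJK /andP[yJ _].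
have iI : i0 \notin I by apply: contra iK; apply: (subsetP sIK).
have iJ : i0 \notin J by apply: contra iK => /(subsetP sJK); rewrite inE => /andP[].
have dIJ u : u \in I -> u \notin J.
  by move=> uI; apply/negP => /(subsetP sJK); rewrite inE uI.
have /eqP/cards2P[i [j [nij eI]]] := hx _ xI.
have /eqP/cards2P[k [l [nkl eJ]]] := hy _ yJ.
have wI := wx _ iI xI; have wJ := wy _ iJ yJ.
have weight2 (u w : 'I_m) : u != w -> weight [set u; w] = mu u + mu w.
  by move=> nuw; rewrite /weight big_setU1 ?big_set1 ?inE.
exists i, j, k, l; split; [|by rewrite -weight2 // -eI|by rewrite -weight2 // -eJ].
have := dIJ i; have := dIJ j; move: iI iJ; rewrite eI eJ !inE !eqxx orbT.
move=> /norP[ni nj] /norP[nk nl] /(_ isT) /norP[njk njl] /(_ isT) /norP[nik nil].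
by rewrite /= !inE !negb_or ni nj nk nl nij nik nil njk njl nkl.
Qed.

End Restriction.

(** * The differential of a diagonal semidirect product *)

Section Differential.
Variables (F : numFieldType) (p : nat) (A : 'M[F]_p).
Hypothesis A_diag : is_diag_mx A.
Implicit Types (X Y : 'rV[F]_(1 + p)) (a : ext F (1 + p)).

Definition idx0 : 'I_(1 + p) := lshift p ord0.

Definition eigen (i : 'I_(1 + p)) : F :=
  if split i is inr j then A j j else 0.

Lemma eigen0 : eigen idx0 = 0.
Proof. by rewrite /eigen (unsplitK (inl _)). Qed.

Lemma eigenS j : eigen (rshift 1 j) = A j j.
Proof. by rewrite /eigen (unsplitK (inr _)). Qed.

Lemma semidirect_bracketE X Y k :
  semidirect_bracket A X Y 0 k = 
  eigen k * (X 0 idx0 * Y 0 k - Y 0 idx0 * X 0 k).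
Proof.
rewrite /semidirect_bracket; case: (split_ordP k) => j ->.
  by rewrite row_mxEl mxE ord1 -/idx0 eigen0 mul0r.
have diagA (Z : 'rV_p) : (Z *m A^T) 0 j = Z 0 j * A j j.
  rewrite mxE (bigD1 j) //= big1 ?addr0 => [|l nlj]; rewrite mxE //.
  by rewrite (is_diag_mxP A_diag) ?mulr0 // eq_sym.
rewrite row_mxEr [LHS]mxE [in LHS]mxE [X in _ + X]mxE [X in _ - X]mxE !diagA.
rewrite !mxE -/idx0 eigenS mulrBr; congr (_ - _).
  by rewrite mulrA mulrC.
by rewrite mulrA mulrC.
Qed.

Local Notation e i := (ebasis F [set i]).

Lemma ce_d1_semidirect k :
  ce_d1 (semidirect_bracket A) (delta_mx 0 k) = - eigen k *: (e idx0 *w e k).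
Proof.
rewrite /ce_d1 (bigD1 idx0) //= [X in _ + X]big1 ?addr0 => [|i ni]; last first.
  rewrite big1 // => j lt_ij; rewrite dual_ev_delta semidirect_bracketE !mxE.
  have nj : (idx0 == j) = false.
    by apply/eqP => j0; rewrite -j0 ltn0 in lt_ij.
  by rewrite (eq_sym idx0) (negPf ni) nj andbF !mul0r subr0 mulr0 oppr0 scale0r.
have [->|nk] := eqVneq k idx0.
  rewrite eigen0 oppr0 scale0r big1 // => j _.
  by rewrite dual_ev_delta semidirect_bracketE eigen0 mul0r oppr0 scale0r.
have k_gt0 : (idx0 < k)%N.
  by rewrite lt0n; apply: contra nk => /eqP k0; apply/eqP/val_inj.
rewrite (bigD1 k) //= big1 ?addr0 => [|j /andP[lt_0j njk]].
  rewrite dual_ev_delta semidirect_bracketE !mxE !eqxx mul1r.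
  by rewrite (eq_sym idx0) (negPf nk) andbF mul0r subr0 mulr1.
rewrite dual_ev_delta semidirect_bracketE !mxE (eq_sym k j) (negPf njk) andbF mulr0.
by rewrite (eq_sym k) (eq_sym idx0 k) (negPf nk) andbF mulr0 subr0 mulr0 oppr0 scale0r.
Qed.

Lemma wedge_interior_basis m (k : 'I_m) I :
  e k *w interior (delta_mx 0 k) (ebasis F I) = (k \in I)%:R *: ebasis F I.
Proof.
rewrite interior_basis; case: ifPn => kI; last by rewrite wedge0r scale0r.
rewrite wedgeZr wedge_basis disjoints1 !inE eqxx scalerA wsign_sq.
by rewrite setD1K.
Qed.

(** The differential is rho |-> - e^0 /\ (A . rho), where A acts on forms as a
    derivation and multiplies e^I by its weight; and e^0 /\ x = 0 means that x
    vanishes on the ideal. *)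
Lemma ce_d_eq0_weightless a : ce_d (semidirect_bracket A) a = 0 ->
  weightless idx0 eigen a.
Proof.
move=> da I iI aI.
pose N : ext F (1 + p) := \sum_J (weight eigen J * a J) *: ebasis F J.
have def_d : ce_d (semidirect_bracket A) a = - (e idx0 *w N).
  rewrite /ce_d; under eq_bigr => k _ do
    rewrite ce_d1_semidirect wedgeZl -wedgeA scaleNr -wedgeZr.
  rewrite sumrN -wedge_sumr; congr (- (_ *w _)).
  have int_k k : e k *w interior (delta_mx 0 k) a =
      \sum_J (a J * (k \in J)%:R) *: ebasis F J.
    rewrite {1}(ext_decomp a) linear_sum /= wedge_sumr; apply: eq_bigr => J _.
    by rewrite linearZ /= wedgeZr wedge_interior_basis scalerA.
  under eq_bigr => k _ do rewrite int_k scaler_sumr.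
  rewrite exchange_big; apply: eq_bigr => J _ /=.
  under eq_bigr => k _ do rewrite scalerA; rewrite -scaler_suml.
  congr (_ *: _); rewrite /weight mulr_suml [RHS]big_mkcond; apply: eq_bigr => k _.
  by case: ifP => _; rewrite ?mulr1 ?mulr0.
move: da; rewrite def_d => /eqP; rewrite oppr_eq0 => /eqP.
rewrite -covec_delta => /restr_eq0P/ffunP/(_ I).
rewrite restrE (negPf iI) [RHS]ffunE ext_sumE (bigD1 I) //= big1 ?addr0 => [|J nJ].
  rewrite ext_scaleE ffunE eqxx mulr1 => /eqP.
  by rewrite mulf_eq0 (negPf aI) orbF => /eqP.
by rewrite ext_scaleE ffunE eq_sym (negPf nJ) mulr0.
Qed.

End Differential.

(** * Complex conjugation *)

Section Conjugation.
Variables (C : numClosedFieldType) (m : nat).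
Implicit Types (I J K : {set 'I_m}) (xi : 'rV[C]_m) (a b x y : ext C m).

(** The analogue of [ext_conj] over any closed field with a conjugation; for R[i]
    the two are convertible. *)
Definition conj_form a : ext C m := [ffun I : {set 'I_m} => (a I)^*].

Lemma conj_formE a I : conj_form a I = (a I)^*.
Proof. by rewrite ffunE. Qed.

Lemma conj_formD a b : conj_form (a + b) = conj_form a + conj_form b.
Proof. by apply/ffunP => I; rewrite !(conj_formE, ext_addE) rmorphD. Qed.

Lemma conj_formZ t a : conj_form (t *: a) = t^* *: conj_form a.
Proof. by apply/ffunP => I; rewrite !(conj_formE, ext_scaleE) rmorphM. Qed.

Lemma conj_form0 : conj_form (0 : ext C m) = 0.
Proof. by apply/ffunP => I; rewrite !(conj_formE, ffunE) rmorph0. Qed.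

Lemma conj_form_wedge a b : conj_form (a *w b) = conj_form a *w conj_form b.
Proof.
apply/ffunP => K; rewrite conj_formE !ffunE rmorph_sum; apply: eq_bigr => I _.
rewrite !rmorphM !conj_formE; congr (_ * _ * _).
rewrite rmorph_prod; apply: eq_bigr => i _; rewrite rmorph_prod.
by apply: eq_bigr => j _; rewrite rmorphXn rmorphN1.
Qed.

Lemma conj_form_covec xi : conj_form (covec xi) = covec (map_mx Num.conj xi).
Proof.
apply/ffunP => I; rewrite conj_formE !ext_sumE rmorph_sum; apply: eq_bigr => i _.
by rewrite !ext_scaleE rmorphM mxE !ffunE rmorph_nat.
Qed.

Lemma homogeneous_conj_form p a : homogeneous p a -> homogeneous p (conj_form a).
Proof. by move=> ha I; rewrite conj_formE fmorph_eq0 => /ha. Qed.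

Lemma restr_conj_form i0 a : restr i0 (conj_form a) = conj_form (restr i0 a).
Proof.
apply/ffunP => I; rewrite !(restrE, conj_formE).
by case: ifP; rewrite ?rmorph0.
Qed.

Variables (i0 : 'I_m) (mu : 'I_m -> C).

Lemma weight0_conj_form a : weight0 mu (conj_form a) = conj_form (weight0 mu a).
Proof.
apply/ffunP => I; rewrite !(weight0E, conj_formE).
by case: ifP; rewrite ?rmorph0.
Qed.

Lemma weightless_conj_form a : weightless i0 mu a -> weightless i0 mu (conj_form a).
Proof. by move=> ha I iI; rewrite conj_formE fmorph_eq0 => /(ha _ iI). Qed.
End Conjugation.

(** * Types 1 and 2 *)

Section Dichotomy.
Variables (C : numClosedFieldType) (m : nat) (i0 : 'I_m).
Local Notation e0 := (delta_mx 0 i0 : 'rV[C]_m).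

Lemma dual_evE (xi X : 'rV[C]_m) : dual_ev xi X = (xi *m X^T) 0 0.
Proof. by rewrite mxE; apply: eq_bigr => i _; rewrite mxE. Qed.

(** Either the covector e^{i0} is independent of the theta_i and their
    conjugates, and some vector separates it from them; or it is a combination
    x + y of both kinds, and being real it is also the mean
    (x + conj y)/2 + (conj x + y)/2. *)
Lemma e0_dichotomy k (theta : 'M[C]_(k, m)) :
  (exists v, [/\ dual_ev e0 v = 1,
                 forall i, dual_ev (row i theta) v = 0
               & forall i, dual_ev (map_mx Num.conj (row i theta)) v = 0])
  \/ (exists D : 'rV[C]_k, e0 = D *m theta + map_mx Num.conj (D *m theta)).
Proof.
pose thetab := map_mx Num.conj theta; pose M := col_mx theta thetab.
have mapK p q (N : 'M[C]_(p, q)) : map_mx Num.conj (map_mx Num.conj N) = N.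
  by apply/matrixP => i j; rewrite !mxE conjCK.
have [/submxP[D def_e0]|] := boolP (e0 <= M)%MS.
  right; pose x := lsubmx D *m theta; pose y := rsubmx D *m thetab.
  have e0xy : e0 = x + y by rewrite def_e0 -[D in LHS]hsubmxK mul_row_col.
  have e0conj : e0 = map_mx Num.conj x + map_mx Num.conj y.
    rewrite -map_mxD -e0xy; apply/rowP => i; rewrite !mxE.
    exact/esym/(rmorph_nat (@Num.conj C)).
  exists (2^-1 *: (lsubmx D + map_mx Num.conj (rsubmx D))).
  have yK : map_mx Num.conj y = map_mx Num.conj (rsubmx D) *m theta.
    by rewrite map_mxM mapK.
  rewrite -scalemxAl mulmxDl -yK -/x map_mxZ map_mxD mapK.
  rewrite fmorphV rmorph_nat -scalerDr.
  transitivity (2^-1 *: (x + y + (map_mx Num.conj x + map_mx Num.conj y))).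
    by rewrite -e0xy -e0conj scalerDr -scalerDl -[2^-1]div1r -splitr scale1r.
  congr (_ *: _); rewrite [map_mx _ x + _]addrC addrACA; congr (_ + _).
  exact: addrC.
rewrite submxE => /eqP ne0.
have [j nj] : exists j, (e0 *m cokermx M) 0 j != 0.
  apply/existsP; apply: contra_notT ne0; rewrite negb_exists => /forallP h.
  by apply/rowP => j; rewrite [RHS]mxE; apply/eqP; rewrite -[_ == _]negbK h.
pose c := (e0 *m cokermx M) 0 j.
have colE (xi : 'rV_m) : dual_ev xi (c^-1 *: (col j (cokermx M))^T) =
    c^-1 * (xi *m cokermx M) 0 j.
  rewrite dual_evE linearZ /= trmxK -scalemxAr mxE; congr (_ * _).
  by rewrite colE mulmxA -colE mxE.
left; exists (c^-1 *: (col j (cokermx M))^T).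
have M0 : M *m cokermx M = 0 by apply: mulmx_coker.
have [M1 M2] : theta *m cokermx M = 0 /\ thetab *m cokermx M = 0.
  by move: M0; rewrite {1}/M mul_col_mx -[0]vsubmxK => /eq_col_mx[-> ->]; rewrite !linear0.
split=> [|i|i]; rewrite colE ?mulVf //.
  by rewrite -row_mul M1 !mxE mulr0.
by rewrite map_row -row_mul M2 !mxE mulr0.
Qed.

End Dichotomy.

Section RealForms.
Variables (C : numClosedFieldType) (m : nat) (i0 : 'I_m) (mu : 'I_m -> C).
Local Notation e0 := (delta_mx 0 i0 : 'rV[C]_m).
Local Notation conj := (@conj_form C m).
Local Notation restr := (restr i0).
Local Notation weight0 := (weight0 mu).
Local Notation weightless := (weightless i0 mu).
Implicit Types (v xi : 'rV[C]_m) (a b x y w T K : ext C m).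

(** A form y contracted to zero by a vector v outside the hyperplane is
    determined by its restriction: if that is 0, then y = e^{i0} /\ i_v y. *)
Lemma restr_neq0_transversal v y : dual_ev e0 v = 1 ->
  interior v y = 0 -> y != 0 -> restr y != 0.
Proof.
move=> v1 vy; apply: contraNneq => /(restr_eq0_interior v1) ->.
by rewrite vy wedge0r.
Qed.

(** If w /\ y vanished on the hyperplane it would be e^{i0} /\ (i_v w) /\ y, so
    that w /\ w /\ y = - (i_v w) /\ e^{i0} /\ w /\ y = 0. *)
Lemma restr_wedge_neq0_transversal v w y : homogeneous 2 w -> dual_ev e0 v = 1 ->
  interior v y = 0 -> w *w (w *w y) != 0 -> restr (w *w y) != 0.
Proof.
move=> hw v1 vy; have evw : even_form w by apply: even_form_homogeneous hw.
apply: contraNneq => r0; have := restr_eq0_interior v1 r0.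
rewrite (interior_wedge_even _ _ evw) vy wedge0r addr0 => def_wy.
move/restr_eq0P: (r0) => e_wy.
have def_iw := homogeneous1_covec (homogeneous_interior hw).
rewrite {1}def_wy (wedgeCA_even_form _ _ evw) (wedgeCA_even_form _ _ evw).
by rewrite def_iw covecCA e_wy wedge0r oppr0.
Qed.

(** In the application a = B + i omega and w = omega, as expressed by [w_im]. *)
Variables (a w : ext C m).
Hypothesis w2 : homogeneous 2 w.
Hypothesis w_im : w = (2 * 'i)^-1 *: (a - conj a).

Let w_even : even_form w. Proof. exact: even_form_homogeneous w2. Qed.

Local Notation two_pairs :=
  (exists i j k l, [/\ uniq [:: i0; i; j; k; l], mu i + mu j = 0 & mu k + mu l = 0]).

Lemma weightless_im x : weightless (a *w x) -> weightless (conj a *w x) ->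
  weightless (w *w x).
Proof.
by move=> ha hc; rewrite w_im; apply: weightless_wedge_comb.
Qed.

Lemma restr_weight0_im x :
    restr (a *w x) = restr (weight0 a *w x) ->
    restr (conj a *w x) = restr (weight0 (conj a) *w x) ->
  restr (w *w x) = restr (weight0 w *w x).
Proof.
by move=> ha hc; rewrite w_im; apply: restr_weight0_comb.
Qed.

Lemma restr_weight0_conj x : restr (a *w x) = restr (weight0 a *w x) ->
  restr (conj a *w conj x) = restr (weight0 (conj a) *w conj x).
Proof.
by move=> ha; rewrite weight0_conj_form -!conj_form_wedge !restr_conj_form ha.
Qed.

Lemma restr_wedge_mulr b x y z :
  restr (b *w x) = restr (y *w x) -> restr (b *w (x *w z)) = restr (y *w (x *w z)).
Proof. by move=> h; rewrite !wedgeA restr_wedge h -restr_wedge. Qed.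

Lemma restr_wedge_congr b x y :
  restr x = restr y -> restr (b *w x) = restr (b *w y).
Proof. by move=> h; rewrite !restr_wedge h. Qed.

Lemma weightless_conjl x : weightless (a *w x) -> weightless (conj a *w conj x).
Proof. by move=> h; rewrite -conj_form_wedge; apply: weightless_conj_form. Qed.

(** Here omega /\ theta /\ conj theta survives on the hyperplane.  The product
    is weightless, and so is y = theta /\ conj theta; so omega can be replaced by
    its part of weight 0. *)
Lemma type1_transversal v xi : let T := covec xi in
    weightless T -> weightless (a *w T) ->
    dual_ev e0 v = 1 -> interior v (T *w conj T) = 0 ->
    w *w (w *w (T *w conj T)) != 0 -> two_pairs.
Proof.
move=> T wT waT v1 vT /(restr_wedge_neq0_transversal w2 v1 vT) neq0.
have wTb : weightless (conj T) by apply: weightless_conj_form.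
have wTT : weightless (T *w conj T) by apply: weightless_wedge.
have hTb : homogeneous 1 (conj T) by apply/homogeneous_conj_form/homogeneous_covec.
apply: (@weight_pairs _ _ i0 mu (weight0 w) (T *w conj T) (ext1 C m)) => //.
- exact: homogeneous_weight0.
- by apply: (@homogeneous_wedge _ _ 1 1) => //; apply: homogeneous_covec.
- exact: weightless_weight0.
rewrite wedge1r -restr_weight0_wedge //.
apply: weightless_im; first by rewrite wedgeA; apply: weightless_wedge.
rewrite /T conj_form_covec covecC -conj_form_covec wedgeNr -scaleN1r.
apply: weightlessZ; rewrite wedgeA; apply: weightless_wedge => //.
exact: weightless_conjl.
Qed.

(** Since T /\ conj T = e^{i0} /\ conj T, the product omega /\ omega /\ conj T
    survives on the hyperplane, where conj T = - T.  So a /\ T and conj a /\ T,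
    hence also omega /\ T, only involve there the parts of weight 0 of a, conj a
    and omega: both factors omega can be replaced, one after the other. *)
Lemma type1_tangent xi : let T := covec xi in
    weightless T -> weightless (a *w T) -> covec e0 = T + conj T ->
    w *w (w *w (T *w conj T)) != 0 -> two_pairs.
Proof.
move=> T wT waT def_e0 neq0.
have rTb : restr (conj T) = - restr T.
  apply/eqP; rewrite -addr_eq0 addrC -linearD /= -def_e0.
  by rewrite restr_eps.
have TTb : T *w conj T = covec e0 *w conj T.
  by rewrite def_e0 wedgeDl /T conj_form_covec covec_sq addr0.
have neq0' : restr (w *w (w *w T)) != 0.
  apply: contraNneq neq0 => r0; rewrite TTb.
  rewrite !(wedgeCA_even_form _ _ w_even).
  suff /restr_eq0P -> : restr (w *w (w *w conj T)) = 0 by [].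
  by move: r0; rewrite !restr_wedge rTb !wedgeNr => ->; rewrite oppr0.
have wT0 : restr (w *w T) = restr (weight0 w *w T).
  have aT0 := restr_weight0_wedge wT waT.
  apply: restr_weight0_im => //.
  have := restr_weight0_conj aT0; rewrite !(restr_wedge _ _ (conj T)) rTb !wedgeNr.
  by move/oppr_inj; rewrite -!restr_wedge.
apply: (@weight_pairs _ _ i0 mu (weight0 w) (weight0 w) T) => //;
  do ?[exact: homogeneous_weight0|exact: weightless_weight0].
rewrite (restr_wedge_congr _ (esym wT0)).
by rewrite -(wedgeCA_even_form _ _ w_even) (restr_wedge_congr _ (esym wT0)).
Qed.

(** Omega and conj Omega are weightless, and their product survives on the
    hyperplane. *)
Lemma type2_transversal v x : homogeneous 2 x -> weightless x ->
    dual_ev e0 v = 1 -> interior v (x *w conj x) = 0 -> x *w conj x != 0 ->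
  two_pairs.
Proof.
move=> x2 wx v1 vx /(restr_neq0_transversal v1 vx) neq0.
apply: (@weight_pairs _ _ i0 mu x (conj x) (ext1 C m)) => //.
- exact: homogeneous_conj_form.
- exact: weightless_conj_form.
by rewrite wedge1r.
Qed.

(** As for type 1, T /\ conj T = e^{i0} /\ conj T, and
    omega /\ T /\ K /\ conj K survives on the hyperplane.  There a can be
    replaced by its part of weight 0 in a /\ T /\ K, and conj a in
    conj a /\ conj T /\ conj K, where conj T = - T; multiplying the first by
    conj K and the second by K, omega can be replaced as well. *)
Lemma type2_tangent xi eta : let T := covec xi in let K := covec eta in
    weightless (T *w K) -> weightless (a *w (T *w K)) -> covec e0 = T + conj T ->
    w *w ((T *w K) *w conj (T *w K)) != 0 -> two_pairs.
Proof.
move=> T K wTK waTK def_e0 neq0.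
have rTb : restr (conj T) = - restr T.
  apply/eqP; rewrite -addr_eq0 addrC -linearD /= -def_e0.
  by rewrite restr_eps.
have TTb : T *w conj T = covec e0 *w conj T.
  by rewrite def_e0 wedgeDl /T conj_form_covec covec_sq addr0.
have def_Y : (T *w K) *w conj (T *w K) = - (covec e0 *w (conj T *w (K *w conj K))).
  rewrite conj_form_wedge -wedgeA [K *w _]wedgeA.
  have -> : K *w conj T = - (conj T *w K) by rewrite /T conj_form_covec covecC.
  rewrite wedgeNl wedgeNr -wedgeA.
  by rewrite wedgeA TTb -wedgeA.
have neq0' : restr (w *w (T *w K *w conj K)) != 0.
  apply: contraNneq neq0 => r0; rewrite def_Y wedgeNr (wedgeCA_even_form _ _ w_even).
  suff /restr_eq0P -> : restr (w *w (conj T *w (K *w conj K))) = 0 by rewrite oppr0.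
  move: r0; rewrite -wedgeA !restr_wedge rTb wedgeNl wedgeNr => ->.
  by rewrite oppr0.
have aTK0 := restr_weight0_wedge wTK waTK.
apply: (@weight_pairs _ _ i0 mu (weight0 w) (T *w K) (conj K)) => //.
- exact: homogeneous_weight0.
- by apply: (@homogeneous_wedge _ _ 1 1); apply: homogeneous_covec.
- exact: weightless_weight0.
rewrite -restr_weight0_im //; first exact: restr_wedge_mulr.
have := restr_weight0_conj aTK0; rewrite conj_form_wedge => /(restr_wedge_mulr K).
rewrite -!wedgeA [conj K *w K](_ : _ = - (K *w conj K)); last first.
  by rewrite /K conj_form_covec covecC.
rewrite !(wedgeNr, linearN) /= => /oppr_inj.
by rewrite !restr_wedge rTb !(wedgeNl, wedgeNr) => /oppr_inj.
Qed.

End RealForms.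

Section LowType.
Variables (C : numClosedFieldType) (m : nat) (i0 : 'I_m) (mu : 'I_m -> C).

(** Being weightless is a condition on each component separately, and Omega and
    a /\ Omega are the components of exp(a) /\ Omega of degrees k and k + 2. *)
Lemma weightless_components k (a Omega : ext C m) :
    homogeneous 2 a -> homogeneous k Omega ->
    weightless i0 mu (wedge_exp a *w Omega) ->
  weightless i0 mu Omega /\ weightless i0 mu (a *w Omega).
Proof.
have m_gt0 : (0 < m)%N by case: i0 => i; apply: leq_ltn_trans.
move=> a2 Ok w_exp; split=> I iI nz.
  apply: w_exp => //; rewrite (wedge_exp_coef (j := 0) a2 Ok) //.
    by rewrite invr1 mul1r [wedge_pow a 0]/= wedge1l.
  exact: Ok nz.
apply: w_exp => //; rewrite (wedge_exp_coef (j := 1) a2 Ok) //.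
  by rewrite invr1 mul1r wedge_powS wedge1r.
exact: (homogeneous_wedge a2 Ok) nz.
Qed.

Lemma conj_form_wedge_family k (t : 'I_k -> 'rV[C]_m) :
  conj_form (wedge_family t) = wedge_family (fun i => map_mx Num.conj (t i)).
Proof.
elim: k t => [|k IHk] t; last by rewrite !wedge_familyS conj_form_wedge conj_form_covec IHk.
rewrite /wedge_family !big_ord0; apply/ffunP => I.
by rewrite conj_formE !ffunE rmorph_nat.
Qed.

(** When e^{i0} = T + conj T, the covector T is a multiple of Omega if k = 1 and
    divides Omega if k = 2. *)
Lemma low_type_pairs k (a w : ext C m) (theta : 'M[C]_(k, m)) (c : C) :
    homogeneous 2 a -> homogeneous 2 w ->
    w = (2 * 'i)^-1 *: (a - conj_form a) ->
    (k = 1 \/ k = 2)%N ->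
  let Omega := c *: wedge_rows theta in
    weightless i0 mu (wedge_exp a *w Omega) ->
    wedge_pow w (3 - k) *w (Omega *w conj_form Omega) != 0 ->
  exists i j k l, [/\ uniq [:: i0; i; j; k; l], mu i + mu j = 0 & mu k + mu l = 0].
Proof.
move=> a2 w2 w_im k12 Om closed nondeg.
have Omk : homogeneous k Om by apply/homogeneousZ/homogeneous_wedge_family.
have [wOm waOm] := weightless_components a2 Omk closed.
have wedgeZ_neq0 t (x y : ext C m) : t != 0 -> x *w (y *w conj_form y) != 0 ->
    x *w (t *: y *w conj_form (t *: y)) != 0.
  move=> t0; rewrite conj_formZ !wedgeZl !wedgeZr !scaler_eq0 fmorph_eq0.
  by rewrite (negPf t0).
have covec_e0_neq0 : covec (delta_mx 0 i0 : 'rV[C]_m) != 0.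
  rewrite covec_delta; apply/eqP => /ffunP/(_ [set i0])/eqP.
  by rewrite !ffunE eqxx oner_eq0.
case: (e0_dichotomy i0 theta) => [[v [v1 v_theta v_thetab]]|[D def_e0]].
  have vY : interior v (Om *w conj_form Om) = 0.
    rewrite (interior_wedge_hom _ _ Omk) conj_formZ conj_form_wedge_family.
    rewrite ![interior v (_ *: _)]linearZ /= wedge_rowsE !interior_wedge_family //.
    by rewrite !scaler0 wedge0l wedge0r scaler0 addr0.
  case: k12 => ek; subst k; move: nondeg; rewrite /wedge_pow /= wedge1r.
    rewrite -wedgeA; have def_Om : Om = covec (c *: row ord0 theta).
      by rewrite covecZ /Om wedge_rowsE wedge_familyS /wedge_family big_ord0 wedge1r.
    rewrite def_Om in wOm waOm vY *.
    exact: (type1_transversal w2 w_im wOm waOm v1 vY).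
  move=> nondeg; apply: (type2_transversal Omk wOm v1 vY).
  by apply: contraNneq nondeg => ->; rewrite wedge0r.
have {def_e0} def_e0 : covec (delta_mx 0 i0) = covec (D *m theta) + conj_form (covec (D *m theta)).
  by rewrite conj_form_covec -covecD -def_e0.
case: k12 => ek; subst k; move: nondeg; rewrite /wedge_pow /= wedge1r.
  rewrite -wedgeA => nondeg.
  have c0 : c != 0.
    by apply: contraNneq nondeg => c0; rewrite /Om c0 scale0r wedge0l !wedge0r.
  have def_T : covec (D *m theta) = (D 0 0 / c) *: Om.
    rewrite /Om wedge_rowsE wedge_familyS /wedge_family big_ord0 wedge1r scalerA divfK //.
    rewrite -covecZ; congr covec; apply/rowP => i.
    by rewrite !mxE big_ord1.
  have D0 : D 0 0 != 0.
    apply: contraNneq covec_e0_neq0 => D0.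
    by rewrite def_e0 def_T D0 mul0r scale0r conj_form0 addr0.
  apply: (type1_tangent w2 w_im _ _ def_e0); rewrite def_T.
  - exact: weightlessZ.
  - by rewrite wedgeZr; apply: weightlessZ.
  rewrite wedgeA; apply: wedgeZ_neq0; first by rewrite mulf_neq0 ?invr_eq0.
  by rewrite -wedgeA.
pose t i := row i theta; pose t0 := covec (t ord0); pose t1 := covec (t (lift ord0 ord0)).
have def_Om : Om = c *: (t0 *w t1).
  by rewrite /Om wedge_rowsE !wedge_familyS /wedge_family big_ord0 wedge1r.
have def_T : covec (D *m theta) = D 0 0 *: t0 + D 0 (lift ord0 ord0) *: t1.
  rewrite -!covecZ -covecD; congr covec; apply/rowP => i.
  by rewrite !mxE big_ord_recl big_ord1.
move=> nondeg.
have [eta def_Om'] : exists eta, Om = covec (D *m theta) *w covec eta.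
  (* c T /\ theta_1 = D_0 Omega and c T /\ theta_0 = - D_1 Omega. *)
  have [D0|D0] := eqVneq (D 0 0) 0; last first.
    exists ((c / D 0 0) *: t (lift ord0 ord0)).
    rewrite covecZ wedgeZr def_T wedgeDl !wedgeZl covec_sq scaler0 addr0.
    by rewrite scalerA divfK.
  have [D1|D1] := eqVneq (D 0 (lift ord0 ord0)) 0.
    case/eqP: covec_e0_neq0; rewrite def_e0 def_T D0 D1 !scale0r addr0 add0r.
    by rewrite conj_form0.
  exists (- (c / D 0 (lift ord0 ord0)) *: t ord0).
  rewrite covecZ wedgeZr def_T D0 scale0r add0r wedgeZl [t1 *w _]covecC.
  by rewrite !scalerN scaleNr opprK scalerA divfK.
rewrite def_Om' in wOm waOm nondeg.
exact: (type2_tangent w2 w_im wOm waOm def_e0).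
Qed.

End LowType.

(** * Opposite pairs in the spectrum *)

Lemma diag_spectrum (F : fieldType) p (A : 'M[F]_p) s :
  is_diag_mx A -> is_spectrum A s -> perm_eq s [seq A i i | i <- enum 'I_p].
Proof.
move=> A_diag A_spec; apply: prod_XsubC_eq.
by rewrite -A_spec big_map big_enum (char_poly_trig (is_diag_mx_is_trig A_diag)).
Qed.

Lemma two_opposite_pairs_intro (F : fieldType) p (f : 'I_p -> F) s i j k l :
    perm_eq s [seq f x | x <- enum 'I_p] -> uniq [:: i; j; k; l] ->
    f i + f j = 0 -> f k + f l = 0 ->
  two_opposite_pairs s.
Proof.
move=> s_perm u4 fij fkl.
exists (f i), (f k), [seq f x | x <- enum 'I_p & x \notin [:: i; j; k; l]].
have -> : - f i = f j by apply/esym/eqP; rewrite -addr_eq0 addrC fij.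
have -> : - f k = f l by apply/esym/eqP; rewrite -addr_eq0 addrC fkl.
apply: (perm_trans s_perm).
rewrite -[X in perm_eq _ X]/([seq f x | x <- [:: i; j; k; l] ++
  [seq x <- enum 'I_p | x \notin [:: i; j; k; l]]]).
apply/perm_map/uniq_perm; first exact: enum_uniq.
  rewrite cat_uniq u4 filter_uniq ?enum_uniq // andbT.
  by apply/hasPn => x; rewrite mem_filter => /andP[].
by move=> x; rewrite mem_cat mem_filter mem_enum andbT orbN.
Qed.

(** Here the closed generator rho' and the generator rho in normal form are only
    related through their annihilators. *)
Lemma semidirect_low_type_pairs (C : numClosedFieldType) p (A : 'M[C]_p) k
    (a w : ext C (1 + p)) (theta : 'M[C]_(k, 1 + p)) (c : C) rho rho' :
    is_diag_mx A ->
    homogeneous 2 a -> homogeneous 2 w -> w = (2 * 'i)^-1 *: (a - conj_form a) ->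
    (k = 1 \/ k = 2)%N -> row_free theta ->
    rho = wedge_exp a *w (c *: wedge_rows theta) ->
    (let Omega := c *: wedge_rows theta in
     wedge_pow w (3 - k) *w (Omega *w conj_form Omega) != 0) ->
    rho' != 0 -> (forall u, clifford u rho = 0 -> clifford u rho' = 0) ->
    ce_d (semidirect_bracket A) rho' = 0 ->
  exists i j k l, [/\ uniq [:: i; j; k; l], A i i + A j j = 0 & A k k + A l l = 0].
Proof.
move=> A_diag a2 w2 w_im k12 theta_free def_rho nondeg rho'0 ann closed'.
have [c' def_rho'] : exists c', rho' = c' *: (wedge_exp a *w wedge_rows theta).
  apply: pure_spinor_unique => // u u0; apply: ann.
  rewrite def_rho wedgeZr /clifford linearZ /= wedgeZr -scalerDr.
  by rewrite [_ + _]u0 scaler0.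
have c'0 : c' != 0 by apply: contraNneq rho'0 => c'0; rewrite def_rho' c'0 scale0r.
have closed : weightless (idx0 p) (eigen A) (wedge_exp a *w (c *: wedge_rows theta)).
  have -> : wedge_exp a *w (c *: wedge_rows theta) = (c / c') *: rho'.
    by rewrite def_rho' scalerA divfK // wedgeZr.
  exact/weightlessZ/ce_d_eq0_weightless.
have [i [j [l [h []]]]] := low_type_pairs a2 w2 w_im k12 closed nondeg.
have idealP x : x != idx0 p -> exists y, x = rshift 1 y.
  by have [y ->|y ->] := split_ordP x; [rewrite ord1 eqxx|exists y].
rewrite /= !inE !negb_or => /and5P[/and4P[]].
rewrite !(eq_sym (idx0 p)).
move=> /idealP[i' ->] /idealP[j' ->] /idealP[l' ->] /idealP[h' ->].
rewrite !eigenS !(inj_eq (@rshift_inj _ _)) => n1 n2 n3 _ eij elh.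
by exists i', j', l', h'; split=> //; rewrite /= !inE !negb_or n1 n2 n3.
Qed.

Theorem corollary4p2 (R : realType) (A : 'M[R]_5) (s : seq R)
  (A_diag : is_diag_mx A) (A_spec : is_spectrum A s)
  (no_identical : ~ two_identical_pairs s)
  (no_opposite : ~ two_opposite_pairs s)
  (J : 'M[R]_((1 + 5) + (1 + 5))) (k : nat) :
  let brC := semidirect_bracket (map_mx (real_complex R) A) in
  is_gcs brC J -> (k = 1 \/ k = 2)%N -> gcs_of_type k J ->
  ~ has_closed_generator brC J.
Proof.
move=> brC _ k12 [rho [_ annJ] [B [omega [theta [c]]]]] /=.
move=> [[B2 om2] [theta_free _] def_rho nondeg] [rho' [rho'0 annJ'] closed'].
have AC_diag : is_diag_mx (map_mx (real_complex R) A).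
  by apply/is_diag_mxP => i j nij; rewrite mxE (is_diag_mxP A_diag).
have complexify2 (b : ext R (1 + 5)) : homogeneous 2 b -> homogeneous 2 (complexify b).
  by move=> hb I; rewrite ffunE fmorph_eq0 => /hb.
have complexify_conj (b : ext R (1 + 5)) : conj_form (complexify b) = complexify b.
  by apply/ffunP => I; rewrite conj_formE ffunE; apply: conjc_real.
have a2 : homogeneous 2 (complexify B + 'i *: complexify omega).
  by apply: homogeneousD; [apply: complexify2|apply/homogeneousZ/complexify2].
have w_im : complexify omega = (2 * 'i)^-1 *:
    (complexify B + 'i *: complexify omega
     - conj_form (complexify B + 'i *: complexify omega)).
  rewrite conj_formD conj_formZ !complexify_conj conjCi scaleNr.
  rewrite opprD opprK addrACA subrr add0r -scalerDl -mulr2n -(mulr_natl 'i).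
  by rewrite scalerA mulVf ?scale1r // mulf_neq0 ?pnatr_eq0 ?neq0Ci.
have ann u : clifford u rho = 0 -> clifford u rho' = 0 by move=> /annJ /annJ'.
have [i [j [l [h [u4 eij elh]]]]] := semidirect_low_type_pairs AC_diag a2
  (complexify2 _ om2) w_im k12 theta_free def_rho nondeg rho'0 ann closed'.
apply: no_opposite; apply: (two_opposite_pairs_intro (diag_spectrum A_diag A_spec) u4).
  by move: eij; rewrite !mxE -rmorphD => /eqP; rewrite fmorph_eq0 => /eqP.
by move: elh; rewrite !mxE -rmorphD => /eqP; rewrite fmorph_eq0 => /eqP.
Qed.
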